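(* Let $\mathcal M$ be a $C$-minimal, $\aleph_0$-categorical structure. Then the subsets $M_1,\dots,M_r$ of the canonical partition of $\mathcal M$ are the orbits over $\emptyset$ of $\mathrm{acl}(\emptyset)$-definable subsets of the following forms: cones; almost thick cones (i.e. cofinite unions of cones at a same basis); pruned cones $\mathcal C(]b,a[)$ where $b<a$ and $]b,a[$ is a dense interval without extremities. All these cones have their basis in $\Theta$, and so is the other extremity (namely $a$) of the axis in the case of pruned cones.
   Context: **$C$-sets and trees.** A $C$-relation on $M$ is a ternary relation $C$ with, for all $x,y,z,w$: $C(x,y,z)\to C(x,z,y)$; $C(x,y,z)\to\neg C(y,x,z)$; $C(x,y,z)\to(C(x,y,w)\vee C(w,y,z))$; $x\neq y\to C(x,y,y)$. A $C$-structure is a set with a $C$-relation and possibly additional structure; it is $C$-minimal if for every elementarily equivalent $N$ every definable subset of $N$ (parameters allowed) is definable by a quantifier-free $\{C\}$-formula with parameters. A structure (or subset) is indiscernible if all its elements have the same complete type over $\emptyset$. A good tree is a partial order in which all sets $\{y:y\le x\}$ are chains, any two elements have a meet, every element is below a maximal element (leaf), and every element is a leaf or a node (the meet of two distinct leaves). $br(\alpha)=\{x:x\le\alpha\}$ for a leaf $\alpha$. The canonical tree $T(M)$ is the unique good tree whose leaves are identified with $M$ so that $C(\alpha,\beta,\gamma)$ iff $br(\alpha)\cap br(\beta)=br(\alpha)\cap br(\gamma)\subsetneq br(\beta)\cap br(\gamma)$. $T(M)^*$ is $T(M)$ if it has a root and $T(M)\cup\{-\infty\}$ with $-\infty<T(M)$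 otherwise (then $-\infty$ is counted in every branch). **Cones** (subsets of $M$). For $x\in T(M)^*$, the thick cone at $x$ is $\mathcal C(x)=\{\gamma\in M:\gamma\ge x\}$; the cones at $x$ are the classes of the relation $\gamma\wedge\gamma'>x$ on $\{\gamma\in M:\gamma>x\}$; for $x<y$ the pruned cone is $\mathcal C(]x,y[)=\{\gamma\in M:x<\gamma\wedge y<y\}$, with axis $]x,y[$. In all cases $x$ is the basis. The orbit over $\emptyset$ of an $\mathrm{acl}(\emptyset)$-definable set is the union of its conjugates under automorphisms. **Canonical partition and $\Theta$.** The canonical partition $(M_1,\dots,M_r)$ of $\mathcal M$ is the unique partition of $M$ into finitely many $\emptyset$-definable subsets which are maximal indiscernible. Each $M_i$ is a finite Boolean combination of cones and thick cones; let $D$ be the set of bases of the cones and thick cones appearing in these combinations. $\Theta_0=\{x\in T(M)^*:x\le c\text{ for some }c\in D\}$; $\Theta_1=\{x\in\Theta_0:\exists i\ne j,\ \alpha\in M_i,\ \beta\in M_j,\ x\in br(\alpha)\cap br(\beta)\}$. $U$ is the set of suprema of branches from $\Theta_1$; $B$ the set of branching points of $\Theta_1$; $S$ the set of $c\in\Theta_1\setminus(U\cup B)$ such that the thick cone at $c$ without the cone of the branch of $\Theta_1$ intersects nontrivially both $M_i$ and $M_j$ for a couple $i\ne j$; $I$ the set of infima, lying in $\Theta_1\setminus(U\cup B\cup S)$, of intervals on branches of $\Theta_1$ which are maximal for being contained in the set of $c\in\Theta_1\setminus(U\cup B\cup S)$ such that the thick cone at $c$ without the cone of the branch of $\Theta_1$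 is entirely contained in a same $M_i$. $\Theta=U\cup B\cup S\cup I$, a finite set.
   Formalization: The thick cone at a leaf (a singleton) is counted as an almost thick cone, although no cones are based at a leaf; otherwise a named point on a dense branch is a counterexample. An ℵ0-categorical structure is taken to be countable, in a countable language. *)

(* Defs.v *)
From HB Require Import structures.
From mathcomp Require Import all_boot all_order.
From mathcomp Require Import boolp classical_sets functions cardinality.

Set Implicit Arguments.
Unset Strict Implicit.
Unset Printing Implicit Defensive.
Import Order.TTheory.

Local Open Scope order_scope.
Local Open Scope card_scope.
Local Open Scope classical_set_scope.

(** * First-order logic with equality *)

Record language := Language {
  fsym : nat -> Type;   (* function symbols of a given arity *)
  rsym : nat -> Type }. (* relation symbols of a given arity *)

Inductive term (L : language) (n : nat) : Type :=
| Var of 'I_n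
| App k of fsym L k & ('I_k -> term L n).

(* Well-scoped de Bruijn syntax: the free variables of [formula L n] are
   indexed by ['I_n], and [FAll] binds the variable [ord0]. *)
Inductive formula (L : language) : nat -> Type :=
| FBot n : formula L n
| FEq n of term L n & term L n : formula L n
| FRel n k of rsym L k & ('I_k -> term L n) : formula L n
| FImp n of formula L n & formula L n : formula L n
| FAll n of formula L n.+1 : formula L n.

Record structure (L : language) := Structure {
  carrier :> Type;
  fint : forall k, fsym L k -> ('I_k -> carrier) -> carrier;
  rint : forall k, rsym L k -> ('I_k -> carrier) -> Prop }.

Section Semantics.
Variables (L : language) (M : structure L).

Definition scons n (x : M) (a : 'I_n -> M) : 'I_n.+1 -> M :=
  fun i => if unlift ord0 i is Some j then a j else x.

Definition env_cat k l (a : 'I_k -> M) (b : 'I_l -> M) : 'I_(k + l) -> M :=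
  fun i => match fintype.split i with inl j => a j | inr j => b j end.

Definition noparam : 'I_0 -> M := fun i => match notF (ltn_ord i) with end.

Fixpoint term_eval n (a : 'I_n -> M) (t : term L n) : M :=
  match t with
  | Var i => a i
  | App _ f ts => fint f (fun i => term_eval a (ts i))
  end.

Fixpoint sat n (phi : formula L n) : ('I_n -> M) -> Prop :=
  match phi with
  | FBot _ => fun _ => False
  | FEq _ t u => fun a => term_eval a t = term_eval a u
  | FRel _ _ R ts => fun a => rint R (fun i => term_eval a (ts i))
  | FImp _ phi1 phi2 => fun a => sat phi1 a -> sat phi2 a
  | FAll _ phi1 => fun a => forall x, sat phi1 (scons x a)
  end.

Definition defset n (phi : formula L n.+1) (a : 'I_n -> M) : set M :=
  [set x | sat phi (scons x a)].

Definition definable (X : set M) : Prop :=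
  exists n (phi : formula L n.+1) (a : 'I_n -> M), X = defset phi a.

Definition definable0 (X : set M) : Prop :=
  exists phi : formula L 1, X = defset phi noparam.

Definition same_type0 (x y : M) : Prop :=
  forall phi : formula L 1, defset phi noparam x <-> defset phi noparam y.

Definition indiscernible (X : set M) : Prop :=
  forall x y, X x -> X y -> same_type0 x y.

(* Definability over acl(0), computed as usual in M^eq, since it has to apply
   to parameters such as the nodes of T(M).  [E] defines an equivalence relation
   on k-tuples, the imaginary a/E is algebraic because [A] holds of [a] and
   meets finitely many E-classes, and [phi] is E-invariant in its parameters, so
   that [X] is definable over a/E.  One imaginary is enough, a finite tuple of
   imaginaries being itself an imaginary. *)
Definition acl0_definable (X : set M) : Prop :=
  exists k (E : formula L (k + k)) (A : formula L k) (phi : formula L k.+1)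
         (a : 'I_k -> M),
    let R (b c : 'I_k -> M) := sat E (env_cat b c) in
    [/\ [/\ forall b, R b b, forall b c, R b c -> R c b
          & forall b c d, R b c -> R c d -> R b d],
        sat A a /\ finite_set [set R b | b in [set b | sat A b]],
        (forall b c, R b c -> defset phi b = defset phi c)
      & X = defset phi a].

End Semantics.

Arguments noparam {L} M.

Fixpoint quantifier_free (L : language) n (phi : formula L n) : Prop :=
  match phi with
  | FImp _ phi1 phi2 => quantifier_free phi1 /\ quantifier_free phi2
  | FAll _ _ => False
  | _ => True
  end.

Definition isomorphism (L : language) (M N : structure L) (f : M -> N) : Prop :=
  [/\ bijective f,
      forall k (s : fsym L k) (a : 'I_k -> M), f (fint s a) = fint s (f \o a)
    & forall k (s : rsym L k) (a : 'I_k -> M), rint s a <-> rint s (f \o a)].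

Definition elem_equiv (L : language) (M N : structure L) : Prop :=
  forall phi : formula L 0, sat phi (noparam M) <-> sat phi (noparam N).

Definition countable_language (L : language) : Prop :=
  forall k, countable [set: fsym L k] /\ countable [set: rsym L k].

(* As usual, an aleph_0-categorical structure is itself countably infinite. *)
Definition aleph0_categorical (L : language) (M : structure L) : Prop :=
  [set: M] #= [set: nat] /\
  forall N : structure L, elem_equiv M N -> [set: N] #= [set: nat] ->
    exists f : M -> N, isomorphism f.

(* The orbit over the empty set of [X]: the union of its conjugates. *)
Definition orbit0 (L : language) (M : structure L) (X : set M) : set M :=
  \bigcup_(s in [set s : M -> M | isomorphism s]) (s @` X).

(** * C-structures and C-minimality *)

Definition is_Crelation (T : Type) (C : T -> T -> T -> Prop) : Prop :=
  [/\ forall x y z, C x y z -> C x z y,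
      forall x y z, C x y z -> ~ C y x z,
      forall x y z w, C x y z -> C x y w \/ C w y z
    & forall x y, x <> y -> C x y y].

Definition Cint (L : language) (C : rsym L 3) (M : structure L) (x y z : M) :
  Prop := rint C (tnth [tuple x; y; z]).

Arguments Cint {L} C M x y z.

Definition Cstructure (L : language) (C : rsym L 3) (M : structure L) : Prop :=
  is_Crelation (Cint C M).

Inductive Csymbol : nat -> Type := Csym : Csymbol 3.

Definition langC : language := Language (fun=> void) Csymbol.

Definition Creduct (L : language) (C : rsym L 3) (M : structure L) :
    structure langC :=
  @Structure langC M
    (fun k (f : void) => match f with end)
    (fun k (s : Csymbol k) =>
       match s in Csymbol k return ('I_k -> M) -> Prop with
       | Csym => rint C
       end).

Definition Cminimal (L : language) (C : rsym L 3) (M : structure L) : Prop :=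
  forall N : structure L, elem_equiv M N ->
  forall X : set N, definable X ->
  exists n (phi : formula langC n.+1) (a : 'I_n -> N),
    quantifier_free phi /\ X = @defset langC (Creduct C N) n phi a.

Definition maximal_for (T : Type) (Q : set (set T)) (A : set T) : Prop :=
  Q A /\ forall B, Q B -> A `<=` B -> B = A.

Definition canonical_partition (L : language) (M : structure L) (r : nat)
    (P : 'I_r -> set M) : Prop :=
  [/\ forall i, P i !=set0,
      forall i j, i <> j -> P i `&` P j = set0,
      \bigcup_i P i = [set: M],
      forall i, definable0 (P i)
    & forall i, maximal_for (@indiscernible L M) (P i)].

(** * Good trees *)

Section Trees.
Context {d : Order.disp_t} (T : meetSemilatticeType d).
Implicit Types x y z : T.

Definition is_leaf x : Prop := forall y, x <= y -> y = x.

Definition is_node x : Prop :=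
  exists a b, [/\ is_leaf a, is_leaf b, a <> b & x = (a `&` b)%O].

Definition good_tree : Prop :=
  [/\ forall x y z, y <= x -> z <= x -> (y <= z) \/ (z <= y),
      forall x, exists2 a, is_leaf a & x <= a
    & forall x, is_leaf x \/ is_node x].

Definition br x : set T := [set y | y <= x].

Definition rooted : Prop := exists r : T, forall x, r <= x.

(* [None] stands for the extra point -oo, present when there is no root. *)
Definition in_star (x : option T) : bool :=
  if x is None then ~~ `[< rooted >] else true.

Record star := Star { star_val :> option T; _ : in_star star_val }.

End Trees.

HB.instance Definition _ d (T : meetSemilatticeType d) :=
  [isSub for @star_val d T].
HB.instance Definition _ d (T : meetSemilatticeType d) :=
  [Choice of star T by <:].

Section StarOrder.
Context {d : Order.disp_t} {T : meetSemilatticeType d}.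

Definition of_tree (x : T) : star T := Star (isT : in_star (Some x)).

Definition star_le (x y : star T) : bool :=
  match star_val x, star_val y with
  | None, _ => true
  | Some _, None => false
  | Some a, Some b => a <= b
  end.

Fact star_le_refl : reflexive star_le.
Proof. by case=> [[a|] h]; rewrite /star_le /=. Qed.

Fact star_le_anti : antisymmetric star_le.
Proof.
move=> [[a|] ha] [[b|] hb] //; rewrite /star_le /= => h; apply: val_inj => //=.
by rewrite (le_anti h).
Qed.

Fact star_le_trans : transitive star_le.
Proof.
move=> [[b|] hb] [[a|] ha] [[c|] hc] //; rewrite /star_le /=.
exact: le_trans.
Qed.

HB.instance Definition _ := Order.Le_isPOrder.Build d (star T)
  star_le_refl star_le_anti star_le_trans.

End StarOrder.

(* [T], with its leaves identified with the elements of [M] by [lf], is the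
   canonical tree of the C-relation [C]. *)
Definition canonical_tree (M : Type) (C : M -> M -> M -> Prop) d
    (T : meetSemilatticeType d) (lf : M -> T) : Prop :=
  [/\ good_tree T, injective lf, range lf = @is_leaf d T
    & forall a b c, C a b c <->
        br (lf a) `&` br (lf b) = br (lf a) `&` br (lf c) /\
        br (lf a) `&` br (lf b) `<` br (lf b) `&` br (lf c)].

(** * Cones *)

Section Cones.
Context {M : Type} {d : Order.disp_t} {T : meetSemilatticeType d}.
Variable lf : M -> T.
Implicit Types (x c : star T) (g : M).

Definition thick_cone x : set M := [set g | x <= of_tree (lf g)].

(* The class of [a] (assumed to lie above [x]) for the relation g /\ g' > x. *)
Definition cone_of x (a : M) : set M :=
  [set g | x < of_tree (lf a `&` lf g)%O].

Definition cones x : set (set M) :=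
  [set cone_of x a | a in [set a | x < of_tree (lf a)]].

(* There is no cone at a leaf, so that the thick cone at a leaf, a singleton,
   has to be counted separately as an almost thick cone. *)
Definition almost_thick_cone x (X : set M) : Prop :=
  (exists2 F : set (set M), F `<=` cones x /\ finite_set (cones x `\` F)
                          & X = \bigcup_(K in F) K)
  \/ ((exists a, x = of_tree (lf a)) /\ X = thick_cone x).

Definition open_itv (x y : star T) : set (star T) := [set z | x < z < y].

Definition pruned_cone x (y : T) : set M :=
  [set g | open_itv x (of_tree y) (of_tree (lf g `&` y)%O)].

Definition dense_without_extremities (J : set (star T)) : Prop :=
  [/\ J !=set0,
      forall u v, J u -> J v -> u < v -> exists2 w, J w & u < w < v,
      forall u, J u -> exists2 v, J v & v < u
    & forall u, J u -> exists2 v, J v & u < v].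

(* Formal finite Boolean combinations of cones and thick cones. *)
Inductive comb : Type :=
| Cone of star T & M
| Thick of star T
| Union of comb & comb
| Inter of comb & comb
| Compl of comb.

Fixpoint comb_wf (e : comb) : Prop :=
  match e with
  | Cone x a => x < of_tree (lf a)
  | Thick _ => True
  | Union e1 e2 | Inter e1 e2 => comb_wf e1 /\ comb_wf e2
  | Compl e1 => comb_wf e1
  end.

Fixpoint comb_set (e : comb) : set M :=
  match e with
  | Cone x a => cone_of x a
  | Thick x => thick_cone x
  | Union e1 e2 => comb_set e1 `|` comb_set e2
  | Inter e1 e2 => comb_set e1 `&` comb_set e2
  | Compl e1 => ~` comb_set e1
  end.

Fixpoint bases (e : comb) : set (star T) :=
  match e with
  | Cone x _ | Thick x => [set x]
  | Union e1 e2 | Inter e1 e2 => bases e1 `|` bases e2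
  | Compl e1 => bases e1
  end.

(** * The set Theta *)

Section Theta.
Variables (r : nat) (P : 'I_r -> set M) (e : 'I_r -> comb).

Definition Theta0 : set (star T) :=
  [set x | exists i, exists2 c, bases (e i) c & x <= c].

Definition Theta1 : set (star T) :=
  [set x | Theta0 x /\ exists i j a b,
    [/\ i <> j, P i a, P j b, x <= of_tree (lf a) & x <= of_tree (lf b)]].

(* Branches of Theta1 are its maximal chains.  When r = 1, Theta1 is empty and
   its only branch is empty, with supremum the least element of T(M)^*. *)
Definition Theta1_branch : set (set (star T)) :=
  maximal_for [set b | b `<=` Theta1 /\
                       forall x y, b x -> b y -> x <= y \/ y <= x].

Definition ThetaU : set (star T) :=
  \bigcup_(b in Theta1_branch) supremums b.

Definition ThetaB : set (star T) :=
  [set c | exists s t : T,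
    [/\ Theta1 (of_tree s), Theta1 (of_tree t), c = of_tree (s `&` t)%O,
        c < of_tree s & c < of_tree t]].

(* The thick cone at [c] without the cone of the branch of Theta1; only used
   for [c] in Theta1 outside U and B, where exactly one cone at [c] contains
   elements of Theta1. *)
Definition side (c : star T) : set M :=
  thick_cone c `\`
  [set g | exists t : T, [/\ Theta1 (of_tree t), c < of_tree t
                           & c < of_tree (t `&` lf g)%O]].

Definition ThetaS : set (star T) :=
  [set c | (Theta1 `\` (ThetaU `|` ThetaB)) c /\
    exists i j, [/\ i <> j, side c `&` P i !=set0 & side c `&` P j !=set0]].

Definition Theta1_rest : set (star T) :=
  Theta1 `\` (ThetaU `|` ThetaB `|` ThetaS).

Definition Theta1_interval (J : set (star T)) : Prop :=
  J !=set0 /\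
  exists2 b, Theta1_branch b & J `<=` b /\
    forall x y z, J x -> J y -> b z -> x <= z <= y -> J z.

(* [i] is fixed along the interval: "a same M_i" refers to the whole of it. *)
Definition ThetaI : set (star T) :=
  [set c | Theta1_rest c /\ exists i J,
    maximal_for [set J | Theta1_interval J /\
                         J `<=` [set x | Theta1_rest x /\ side x `<=` P i]] J
    /\ infimums J c].

Definition Theta : set (star T) := ThetaU `|` ThetaB `|` ThetaS `|` ThetaI.

End Theta.
End Cones.

(* Main.v *)
Require Import Defs.
From mathcomp Require Import all_boot all_order.
From mathcomp Require Import boolp classical_sets functions cardinality filter.

(** A node of T(M)^* lies in Theta1 exactly when its thick cone meets two of
    the M_i, so Theta1 depends only on the partition.  If x < y lie below the
    same bases of the given Boolean combinations, then the thick cone at x minus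
    the thick cone at y lies in a single M_i.  As there are finitely many bases,
    the branches of Theta1 and the intervals defining I have suprema and infima,
    and there are finitely many of these intervals.

    Take g in M_i and cut br(g) by Theta1.  If Theta1 has no last point on br(g),
    the cut has a supremum u in U, and X is the thick cone at u.  Otherwise let x
    be the last point.  If x is outside Theta1 \ (U, B, S), or alone in its
    maximal interval, then x is in Theta and X is the cone of g at x, or the
    union of all cones at x inside M_i when there are infinitely many of them,
    which is then a cofinite union.  If x is not alone in its interval J, the
    automorphisms preserving J are transitive on J, because M_i is
    indiscernible; so J has no endpoints, and it is dense since a discrete J
    would produce infinitely many 2-types.  Then X is the pruned cone with axis J.

    The model-theoretic input is the Ryll-Nardzewski theorem: in an
    aleph_0-categorical structure every type of a tuple is isolated (a generic
    Henkin construction would omit a nonisolated one), hence tuples of the same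
    type are conjugate; there are finitely many 2-types; and a definable set
    with finitely many conjugates is acl(0)-definable. *)

Set Implicit Arguments.
Unset Strict Implicit.
Unset Printing Implicit Defensive.
Import Order.TTheory.

Local Open Scope card_scope.
Local Open Scope classical_set_scope.

(** * First-order model theory *)

(** The combinations [e] that define Theta need not be respected by automorphisms. They are
    therefore used only for counting: a point is labelled by the set of bases above it, and points
    of Theta1 with the same label are comparable. If the label of the image of a point x determines
    the image of a set attached to x, that set has finitely many conjugates. Everything that has to
    be invariant (Theta1, its intervals, the last points of the cuts) is restated through the
    partition alone. The tree has meets but need not have suprema; the labels also supply these, as
    meets of finitely many bases. A second obstacle is -oo. It is fixed by all automorphisms and has
    a single cone, so its side is empty and the homogeneity of M_i says nothing about it. It is
    removed from the intervals before automorphisms are applied. No quotient M^eq is built: an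
    automorphism acts on nodes through the leaves above them. *)

Section Definability.
Variables (L : language) (M : structure L).
Implicit Types (R : (nat -> M) -> Prop) (s : nat -> M).

(** * Renaming of variables and closure properties of definable relations *)

Lemma sat_ext n (phi : formula L n) (a b : 'I_n -> M) :
  a =1 b -> sat phi a = sat phi b.
Proof. by move=> /funext ->. Qed.

Fixpoint rename_term m n (f : 'I_m -> 'I_n) (t : term L m) : term L n :=
  match t with
  | Var i => Var L (f i)
  | App _ g ts => App g (fun i => rename_term f (ts i))
  end.

Definition lift_renaming m n (f : 'I_m -> 'I_n) : 'I_m.+1 -> 'I_n.+1 :=
  fun i => if unlift ord0 i is Some j then lift ord0 (f j) else ord0.

Fixpoint rename m (phi : formula L m) : forall n, ('I_m -> 'I_n) -> formula L n :=
  match phi with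
  | FBot _ => fun n _ => FBot L n
  | FEq _ t u => fun n f => FEq (rename_term f t) (rename_term f u)
  | FRel _ _ R ts => fun n f => FRel R (fun i => rename_term f (ts i))
  | FImp _ phi1 phi2 => fun n f => FImp (rename phi1 f) (rename phi2 f)
  | FAll _ phi1 => fun n f => FAll (rename phi1 (lift_renaming f))
  end.

Lemma rename_term_eval m n (f : 'I_m -> 'I_n) (t : term L m) (a : 'I_n -> M) :
  term_eval a (rename_term f t) = term_eval (a \o f) t.
Proof.
by elim: t => //= k g ts IH; congr fint; apply/funext => i; rewrite IH.
Qed.

Lemma scons_lift_renaming m n (f : 'I_m -> 'I_n) x (a : 'I_n -> M) :
  scons x a \o lift_renaming f = scons x (a \o f).
Proof.
apply/funext => i; rewrite /scons /lift_renaming /=.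
by case: (unliftP ord0 i) => [j _|_]; rewrite ?liftK ?unlift_none.
Qed.

Lemma sat_rename m n (f : 'I_m -> 'I_n) (phi : formula L m) (a : 'I_n -> M) :
  sat (rename phi f) a <-> sat phi (a \o f).
Proof.
elim: phi n f a => {m} [m|m t u|m k R ts|m phi1 IH1 phi2 IH2|m phi IH] n f a //=.
- by rewrite !rename_term_eval.
- have -> // : (fun i => term_eval a (rename_term f (ts i))) =
    (fun i => term_eval (a \o f) (ts i)).
  by apply/funext => i; rewrite rename_term_eval.
- by rewrite IH1 IH2.
- by split=> H x; have := H x; rewrite IH scons_lift_renaming.
Qed.

(* Definable relations are handled as predicates on infinite assignments, so
   that renaming and quantification need no arithmetic on contexts. *)
Definition fdef R : Prop :=
  exists m (phi : formula L m), forall s, sat phi (fun i => s i) <-> R s.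

Definition push (x : M) s : nat -> M := fun n => if n is k.+1 then s k else x.

Lemma push_scons m x s :
  (fun i : 'I_m => push x s i) =
  scons x (fun i : 'I_m => s i) \o widen_ord (leqnSn m).
Proof.
apply/funext => i; rewrite /= /scons.
by case: (unliftP ord0 _) => [j|] /(congr1 (@nat_of_ord _)) /= ->.
Qed.

Lemma fdef_ext R R' : (forall s, R s <-> R' s) -> fdef R -> fdef R'.
Proof.
by move=> RR' [m [phi H]]; exists m, phi => s; rewrite H.
Qed.

Lemma fdef_support R : fdef R ->
  exists m, forall s s', (forall i, (i < m)%N -> s i = s' i) -> R s -> R s'.
Proof.
move=> [m [phi H]]; exists m => s s' ss' /H Rs; apply/H.
by rewrite -(sat_ext phi (a := fun i => s i)) // => i; exact: ss'.
Qed.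

Lemma fdef_sat n (phi : formula L n) (a : 'I_n -> nat) :
  fdef (fun s => sat phi (s \o a)).
Proof.
exists (\max_(i < n) a i).+1, (rename phi (fun i => inord (a i))) => s.
rewrite sat_rename (@sat_ext _ _ _ (s \o a)) // => i /=.
by rewrite inordK // ltnS; exact: (leq_bigmax i).
Qed.

Lemma fdef_ren R (f : nat -> nat) : fdef R -> fdef (fun s => R (s \o f)).
Proof.
move=> [m [phi H]]; apply: fdef_ext (fdef_sat phi (fun i => f i)) => s.
by rewrite -H.
Qed.

Lemma fdef_false : fdef (fun=> False).
Proof. by exists 0%N, (FBot L 0) => s. Qed.

Lemma fdef_imp R R' : fdef R -> fdef R' -> fdef (fun s => R s -> R' s).
Proof.
move=> [m [phi H]] [m' [phi' H']].
exists (maxn m m'), (FImp (rename phi (widen_ord (leq_maxl m m')))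
                          (rename phi' (widen_ord (leq_maxr m m')))) => s /=.
by rewrite !sat_rename -H -H'.
Qed.

Lemma fdef_not R : fdef R -> fdef (fun s => ~ R s).
Proof. by move=> dR; apply: fdef_imp dR fdef_false. Qed.

Lemma fdef_and R R' : fdef R -> fdef R' -> fdef (fun s => R s /\ R' s).
Proof.
move=> dR dR'; apply: fdef_ext (fdef_not (fdef_imp dR (fdef_not dR'))) => s.
by rewrite not_implyE notK.
Qed.

Lemma fdef_or R R' : fdef R -> fdef R' -> fdef (fun s => R s \/ R' s).
Proof.
move=> dR dR'; apply: fdef_ext (fdef_imp (fdef_not dR) dR') => s.
split=> [H|[Rs|Rs' _]] //; case: (pselect (R s)) => Rs; [by left|right].
exact: H.
Qed.

Lemma fdef_all R : fdef R -> fdef (fun s => forall x, R (push x s)).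
Proof.
move=> [m [phi H]].
exists m, (FAll (rename phi (widen_ord (leqnSn m)))) => s /=.
have E x : sat (rename phi (widen_ord (leqnSn m))) (scons x (fun i => s i)) <->
    R (push x s) by rewrite sat_rename -H -push_scons.
by split=> A x; apply/E.
Qed.

Lemma fdef_ex R : fdef R -> fdef (fun s => exists x, R (push x s)).
Proof.
move=> dR; apply: fdef_ext (fdef_not (fdef_all (fdef_not dR))) => s.
by rewrite -existsNE; split=> [[x]|[x Rx]]; [rewrite notK; exists x|exists x; rewrite notK].
Qed.

Lemma fdef_eq i j : fdef (fun s => s i = s j).
Proof.
pose a (k : 'I_2) := if k == ord0 then i else j.
by apply: fdef_ext (fdef_sat (FEq (Var L (ord0 : 'I_2)) (Var L ord_max)) a) => s.
Qed.

Lemma fdef_forall_ord n (R : 'I_n -> (nat -> M) -> Prop) :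
  (forall i, fdef (R i)) -> fdef (fun s => forall i, R i s).
Proof.
elim: n R => [|n IH] R dR.
  by apply: fdef_ext (fdef_not fdef_false) => s; split=> // _ [].
have := fdef_and (dR ord0) (IH (fun i => R (lift ord0 i)) (fun i => dR _)).
apply: fdef_ext => s; split=> [[R0 RS] i|RA]; last by split=> // i.
by case: (unliftP ord0 i) => [j|] ->.
Qed.

(** The effect of [m] successive pushes, so that a block of quantifiers is handled at once. *)
Definition join_assign m (t s : nat -> M) : nat -> M :=
  fun n => if (n < m)%N then t n else s (n - m)%N.

Lemma push_join m t s :
  join_assign m.+1 t s = push (t 0%N) (join_assign m (t \o S) s).
Proof. by apply/funext => -[|n]. Qed.

Lemma fdef_exs m R : fdef R ->
  fdef (fun s => exists t, R (join_assign m t s)).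
Proof.
elim: m R => [|m IH] R dR.
  apply: fdef_ext (dR) => s.
  have E t : join_assign 0 t s = s by apply/funext => n; rewrite /join_assign subn0.
  by split=> [Rs|[t]]; [exists s|]; rewrite E.
apply: fdef_ext (IH _ (fdef_ex dR)) => s; split=> [[t [x Rx]]|[t Rt]].
  by exists (push x t); rewrite push_join.
by exists (t \o S), (t 0%N); rewrite -push_join.
Qed.

Lemma fdef_definable R s : fdef R -> definable [set x | R (push x s)].
Proof.
move=> [m [phi H]].
exists m, (rename phi (widen_ord (leqnSn m))), (fun i => s i).
by apply/seteqP; split=> x; rewrite /defset /= sat_rename -push_scons H.
Qed.

(** The context is nonempty, so [inord] can absorb the variables of [phi] beyond the first [n.+1];
    the relation does not depend on them. *)
Lemma fdef_formula n (R : ('I_n.+1 -> M) -> Prop) :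
  fdef (fun s => R (fun i => s i)) ->
  exists phi : formula L n.+1, forall a, sat phi a <-> R a.
Proof.
move=> [m [phi H]].
exists (rename phi (fun i => inord i)) => a.
rewrite sat_rename; have := H (fun k => a (inord k)) => /=.
have -> // : (fun i : 'I_n.+1 => a (inord i)) = a.
by apply/funext => i; rewrite inord_val.
Qed.

End Definability.

(** * Isomorphisms preserve satisfaction *)

Lemma term_eval_iso (L : language) (M N : structure L) (f : M -> N) n
    (a : 'I_n -> M) (t : term L n) :
  isomorphism f -> term_eval (f \o a) t = f (term_eval a t).
Proof.
move=> [_ ff _]; elim: t => //= k g ts IH.
by rewrite ff; congr fint; apply/funext => i; rewrite /= IH.
Qed.

Lemma iso_sat (L : language) (M N : structure L) (f : M -> N) n
    (phi : formula L n) (a : 'I_n -> M) :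
  isomorphism f -> sat phi (f \o a) <-> sat phi a.
Proof.
move=> fi; have [[g fK gK] _ fr] := fi.
elim: phi a => {n} [n|n t u|n k R ts|n phi1 IH1 phi2 IH2|n phi IH] a //=.
- by rewrite !term_eval_iso //; split=> [/(can_inj fK)|->].
- rewrite fr; suff -> : (fun i => term_eval (f \o a) (ts i)) =
    f \o (fun i => term_eval a (ts i)) by [].
  by apply/funext => i; rewrite term_eval_iso.
- by rewrite IH1 IH2.
- have E x : scons (f x) (f \o a) = f \o scons x a.
    by apply/funext => i; rewrite /scons /=; case: unlift.
  split=> H x; first by apply/IH; rewrite -E.
  by rewrite -(gK x) E IH.
Qed.

(** * A countable ultralimit of assignments with Henkin witnesses *)

Section Ultralimit.
Variables (L : language) (M : structure L) (s : nat -> nat -> M).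
Hypothesis M_infinite : infinite_set [set: M].
Hypothesis henkin : forall n (phi : formula L n.+1) (a : 'I_n -> nat),
  exists j, exists k0, forall k, (k0 <= k)%N ->
    (exists x, sat phi (scons x (s k \o a))) ->
    sat phi (scons (s k j) (s k \o a)).

Variable U : set_system nat.
Hypothesis U_ultra : UltraFilter U.
Hypothesis U_cofinal : forall k0, U [set k | (k0 <= k)%N].

Let U_filter : ProperFilter U := @ultra_proper _ _ U_ultra.

Let U_forall n (A : 'I_n -> set nat) :
  (forall i, U (A i)) -> U [set k | forall i, A i k].
Proof. by move=> UA; exact: filter_forall. Qed.

(** Of the ultrapower only the sequences [k => s k i] are kept. An element is coded by the least
    index of its class, which makes the limit countable. *)
Let same i : pred nat := fun j => `[< U [set k | s k j = s k i] >].

Let exists_same i : exists j, same i j.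
Proof. by exists i; apply/asboolP; apply: filterE. Qed.

Let rep i := ex_minn (exists_same i).

Let rep_same i : U [set k | s k (rep i) = s k i].
Proof. by rewrite /rep; case: ex_minnP => j /asboolP. Qed.

Let same_rep i j : U [set k | s k i = s k j] -> rep i = rep j.
Proof.
have half i' j' : U [set k | s k i' = s k j'] -> (rep i' <= rep j')%N.
  move=> Uij; rewrite {1}/rep; case: ex_minnP => m _; apply; apply/asboolP.
  by apply: filterS2 Uij (rep_same j') => k /= -> ->.
move=> Uij; apply/eqP; rewrite eqn_leq !half //.
by apply: filterS Uij.
Qed.

Let rep_id i : rep (rep i) == rep i.
Proof. by apply/eqP/same_rep/rep_same. Qed.

Let carrierN' : countType := {i : nat | rep i == i}.
Let carrierN : Type := carrierN'.
Let h i : carrierN := exist _ (rep i) (rep_id i).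

Let h_val (y : carrierN) : h (val y) = y.
Proof. by apply: val_inj => /=; apply/eqP/(valP y). Qed.

(** Closure under functions is the Henkin property of the formula x = g(c). *)
Let choose_fun k (g : Defs.fsym L k) (c : 'I_k -> carrierN) : exists j,
  U [set m | s m j = fint g (s m \o (val \o c))].
Proof.
set phi := FEq (Var L ord0) (App g (fun i => Var L (lift ord0 i))).
have phiP x b : sat phi (scons x b) <-> x = fint g b.
  rewrite /= {1}/scons unlift_none.
  suff -> : (fun i : 'I_k => scons x b (lift ord0 i)) = b by [].
  by apply/funext => i; rewrite /scons liftK.
have [j [k0 H]] := henkin phi (val \o c).
exists j; apply: filterS (U_cofinal k0) => m /= /H {}H.
by apply/phiP/H; exists (fint g (s m \o (val \o c))); apply/phiP.
Qed.

Let N : structure L := @Structure L carrierN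
  (fun k g c => h (projT1 (cid (choose_fun g c))))
  (fun k R c => U [set m | rint R (s m \o (val \o c))]).

Let los_term n (t : term L n) (c : 'I_n -> N) :
  U [set k | s k (val (term_eval c t)) = term_eval (s k \o (val \o c)) t].
Proof.
elim: t => [i|k g ts IH] /=; first exact: filterE.
case: cid => j /= Hj.
apply: filterS2 (U_forall IH) (filterI (rep_same j) Hj) => // m /= A [-> ->].
by congr fint; apply/funext => i; exact: A.
Qed.

Let los n (phi : formula L n) (c : 'I_n -> N) :
  sat phi c <-> U [set k | sat phi (s k \o (val \o c))].
Proof.
elim: phi c => {n} [n|n t u|n k R ts|n phi1 IH1 phi2 IH2|n phi IH] c /=.
- by split=> // /filter_ex [].
- have Ut := los_term t c; have Uu := los_term u c; split=> [E|H].
    by rewrite E in Ut; apply: filterS2 Ut Uu => m /= -> ->.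
  rewrite -(h_val (term_eval c t)) -(h_val (term_eval c u)).
  apply: val_inj; apply: same_rep.
  by apply: filterS2 H (filterI Ut Uu) => m /= E [-> ->].
- have Uts : U [set m | s m \o (val \o (fun i => term_eval c (ts i))) =
      fun i => term_eval (s m \o (val \o c)) (ts i)].
    apply: filterS (U_forall (fun i => los_term (ts i) c)) => m Em.
    by apply/funext => i; exact: Em.
  by split=> H; apply: filterS2 H Uts => m /= + E; rewrite E.
- rewrite IH1 IH2; split=> [H|H H1].
    have [/H|] := in_ultra_setVsetC [set k | sat phi1 (s k \o (val \o c))] U_ultra.
      by apply: filterS => m /=.
    by apply: filterS => m /=.
  by apply: filterS2 H H1 => m /= H; exact: H.
- have E y k : s k \o (val \o scons y c) = scons (s k (val y)) (s k \o (val \o c)).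
    by apply/funext => i; rewrite /scons /=; case: unlift.
  split=> [H|H y]; last first.
    by apply/IH; apply: filterS H => m /=; rewrite E.
  have [//|] := in_ultra_setVsetC
    [set k | forall x, sat phi (scons x (s k \o (val \o c)))] U_ultra.
  (* The witness is taken for the negation: if the universal formula failed almost everywhere, the
     value at index [j] would violate [phi]. *)
  have [j [k0 Hj]] := henkin (FImp phi (FBot L _)) (val \o c).
  move=> A; have /IH {}H := H (h j).
  have [m /= [[[m0 Am] Hm] mj]] := filter_ex (filterI (filterI
    (filterI (U_cofinal k0) A) H) (rep_same j)).
  move: Hm; rewrite E /= mj => Hm.
  case: (Hj m m0); last exact: Hm.
  by have /existsNP [x nx] := Am; exists x.
Qed.

Let h_same n (a : 'I_n -> nat) :
  U [set k | s k \o (val \o (h \o a)) = s k \o a].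
Proof.
apply: filterS (U_forall (fun i => rep_same (a i))) => // m /= E.
by apply/funext => i /=.
Qed.

Let los_h n (phi : formula L n) (a : 'I_n -> nat) :
  (exists k0, forall k, (k0 <= k)%N -> sat phi (s k \o a)) ->
  sat phi (h \o a : 'I_n -> N).
Proof.
move=> [k0 H]; apply/los; apply: filterS2 (U_cofinal k0) (h_same a) => m /H.
by move=> /= + ->.
Qed.

(** As [M] is infinite, the Henkin property yields an index whose value eventually differs from
    those at any finite list of indices. *)
Let N_infinite : infinite_set [set: N].
Proof.
move=> /(@finite_seqP carrierN') [t tP].
set n := size t; pose a (i : 'I_n) := val (nth (h 0) t i).
have [phi phiP] : exists phi : formula L n.+1, forall b : 'I_n.+1 -> M,
    sat phi b <-> forall i, b ord0 <> b (lift ord0 i).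
  apply: fdef_formula; apply: fdef_forall_ord => i.
  by apply: fdef_not; apply: fdef_eq.
have [j [k0 H]] := henkin phi a.
have : [set: carrierN'] (h j) by [].
rewrite tP /= => /(nthP (h 0)) [i i_lt ti].
have Uij : U [set k | s k (a (Ordinal i_lt)) = s k j].
  by rewrite /a /= ti; exact: rep_same.
have [m /= [mk E]] := filter_ex (filterI (U_cofinal k0) Uij).
have /phiP/(_ (Ordinal i_lt)) : sat phi (scons (s m j) (s m \o a)).
  apply: H => //; have [x xP] : exists x, forall i : 'I_n, x <> s m (a i).
    apply: contrapT => /forallNP Hx; apply: M_infinite.
    apply: (@sub_finite_set _ _ (range (fun i : 'I_n => s m (a i)))); last first.
      by apply: finite_image; exact: finite_finset.
    by move=> x _; have /existsNP [i' /contrapT ->] := Hx x; exists i'.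
  by exists x; apply/phiP => i'; rewrite /scons unlift_none liftK; exact: xP.
by rewrite /scons unlift_none liftK /= E => /(_ erefl).
Qed.

(* The pointwise ultralimit of the assignments [s k]. *)
Lemma ultralimit_aux : exists (N : structure L) (h : nat -> N),
  [/\ forall y, exists i, h i = y,
      [set: N] #= [set: nat],
      elem_equiv M N
    & forall n (phi : formula L n) (a : 'I_n -> nat),
        (exists k0, forall k, (k0 <= k)%N -> sat phi (s k \o a)) ->
        sat phi (h \o a)].
Proof.
exists N, h; split; last exact: los_h.
- by move=> y; exists (val y); exact: h_val.
- apply: eq_card_nat N_infinite; exact: (@countableP carrierN').
- move=> phi; have E k : s k \o (val \o noparam N) = noparam M.
    by apply/funext => -[].
  rewrite los; split=> [H|/filter_ex [k /=]]; last by rewrite E.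
  by apply: filterE => k /=; rewrite E.
Qed.
End Ultralimit.

Lemma ultralimit (L : language) (M : structure L) (s : nat -> nat -> M) :
  infinite_set [set: M] ->
  (forall n (phi : formula L n.+1) (a : 'I_n -> nat),
    exists j, exists k0, forall k, (k0 <= k)%N ->
      (exists x, sat phi (scons x (s k \o a))) ->
      sat phi (scons (s k j) (s k \o a))) ->
  exists (N : structure L) (h : nat -> N),
  [/\ forall y, exists i, h i = y,
      [set: N] #= [set: nat],
      elem_equiv M N
    & forall n (phi : formula L n) (a : 'I_n -> nat),
        (exists k0, forall k, (k0 <= k)%N -> sat phi (s k \o a)) ->
        sat phi (h \o a)].
Proof.
move=> Minf hs; have [U [UU sU]] := ultraFilterLemma eventually_filter.
by apply: (ultralimit_aux Minf hs UU) => k0; apply: sU; exists k0.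
Qed.

(** * Countability of the set of formulas *)

Section FormulaCodes.
Variables (L : language) (cf : forall k, Defs.fsym L k -> nat)
  (cr : forall k, rsym L k -> nat).
Hypotheses (cf_inj : forall k, injective (@cf k))
  (cr_inj : forall k, injective (@cr k)).

(** The arity is part of the code, so that it can be identified before the dependently typed symbols
    and arguments are compared. *)
Fixpoint term_code n (t : term L n) : GenTree.tree nat :=
  match t with
  | Var i => GenTree.Leaf (nat_of_ord i)
  | App k g ts =>
      GenTree.Node k (GenTree.Leaf (cf g) :: [seq term_code (ts i) | i <- enum 'I_k])
  end.

Fixpoint formula_code n (phi : formula L n) : GenTree.tree nat :=
  match phi with
  | FBot _ => GenTree.Node 0 [::]
  | FEq _ t u => GenTree.Node 1 [:: term_code t; term_code u]
  | FRel _ k R ts =>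
      GenTree.Node 2 (GenTree.Leaf k :: GenTree.Leaf (cr R) ::
                      [seq term_code (ts i) | i <- enum 'I_k])
  | FImp _ phi1 phi2 => GenTree.Node 3 [:: formula_code phi1; formula_code phi2]
  | FAll _ phi1 => GenTree.Node 4 [:: formula_code phi1]
  end.

Lemma term_code_inj n : injective (@term_code n).
Proof.
elim=> [i|k g ts IH] [j|k' g' ts'] //= [].
  by move=> /ord_inj ->.
move=> E; case: k' / E g' ts' => g' ts' /cf_inj -> /eq_in_map E.
by congr App; apply/funext => i; apply/IH/E; rewrite mem_enum.
Qed.

Lemma formula_code_inj n : injective (@formula_code n).
Proof.
elim=> {n} [n|n t u|n k R ts|n phi1 IH1 phi2 IH2|n phi IH] psi.
- by case: n / psi.
- by case: n / psi t u => //= n t' u' t u [/term_code_inj -> /term_code_inj ->].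
- case: n / psi ts => //= n k' R' ts' ts [] E.
  case: k' / E R' ts' => R' ts' /cr_inj -> /eq_in_map E.
  by congr FRel; apply/funext => i; apply/term_code_inj/E; rewrite mem_enum.
- by case: n / psi phi1 phi2 IH1 IH2 => //= n p1 p2 q1 q2 IH1 IH2 [/IH1 -> /IH2 ->].
- by case: n / psi phi IH => //= n p q IH [/IH ->].
Qed.
End FormulaCodes.

(** * Enumerations and generic models *)

Lemma enum_surj (X : Type) (K : countType) (f : X -> K) (x0 : X) :
  injective f -> exists e : nat -> X, forall x, exists k, e k = x.
Proof.
move=> finj.
exists (fun k => if pselect (exists x, pickle (f x) = k) is left H
                 then projT1 (cid H) else x0) => x.
exists (pickle (f x)); case: pselect => [H|[]]; last by exists x.
by case: cid => y /= /(pcan_inj (@pickleK _)) /finj.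
Qed.

Lemma henkin_enum (L : language) : countable_language L ->
  exists e : nat -> {n & (formula L n.+1 * ('I_n -> nat))%type},
    forall n phi (a : 'I_n -> nat), exists k, e k = existT _ n (phi, a).
Proof.
move=> cL.
have codes (F : nat -> Type) : (forall k, countable [set: F k]) ->
    exists c : forall k, F k -> nat, forall k, injective (c k).
  move=> cF; have ex k : exists f : F k -> nat, injective f.
    have /countable_injP [f finj] := cF k.
    by exists f => x y; apply: finj; rewrite inE.
  by exists (fun k => projT1 (cid (ex k))) => k; case: cid.
have [cf cf_inj] := codes _ (fun k => (cL k).1).
have [cr cr_inj] := codes _ (fun k => (cL k).2).
pose X := {n & (formula L n.+1 * ('I_n -> nat))%type}.
pose f (x : X) := (projT1 x, formula_code cf cr (projT2 x).1,
                   [seq (projT2 x).2 i | i <- enum 'I_(projT1 x)]).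
have finj : injective f.
  move=> [n [phi a]] [n' [phi' a']] [] /= E.
  case: n' / E phi' a' => phi' a' /(formula_code_inj cf_inj cr_inj) -> /eq_in_map E.
  suff -> : a = a' by [].
  by apply/funext => i; apply: E; rewrite mem_enum.
have [e eP] := enum_surj (existT _ 0%N (FBot L 1, fun=> 0%N)) finj.
by exists e => n phi a; apply: eP.
Qed.

(* Henkin construction by successive conditions: [large] is the consistency
   notion, and only the coordinates below [m0] matter for it. *)
Lemma generic_model (L : language) (M : structure L) (m0 : nat)
    (large : ((nat -> M) -> Prop) -> Prop)
    (Q : nat -> ((nat -> M) -> Prop) -> Prop) :
  countable_language L -> infinite_set [set: M] ->
  large (fun=> True) ->
  (forall S, large S -> exists s, S s) ->
  (forall S S' : (nat -> M) -> Prop, large S ->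
     (forall s, S s -> exists2 s', S' s' & forall i, (i < m0)%N -> s' i = s i) ->
     large S') ->
  (forall k S, fdef S -> large S -> exists S',
     [/\ fdef S', large S', forall s, S' s -> S s & Q k S']) ->
  exists (N : structure L) (h : nat -> N),
  [/\ forall y, exists i, h i = y,
      [set: N] #= [set: nat],
      elem_equiv M N
    & forall k, exists2 S, Q k S & forall n (phi : formula L n) (a : 'I_n -> nat),
        (forall s, S s -> sat phi (s \o a)) -> sat phi (h \o a)].
Proof.
move=> cL Minf largeT large_ex large_mono Q_dense.
have [e eP] := henkin_enum cL.
pose H (x : {n & (formula L n.+1 * ('I_n -> nat))%type}) j (s : nat -> M) :=
  let (phi, a) := projT2 x in
  (exists x, sat phi (scons x (s \o a))) -> sat phi (scons (s j) (s \o a)).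
pose cond := {S : (nat -> M) -> Prop | fdef S /\ large S}.
have step k (S : cond) : exists S' : cond,
    [/\ forall s, sval S' s -> sval S s, Q k (sval S')
      & exists j, forall s, sval S' s -> H (e k) j s].
  case: S => S [dS lS] /=; rewrite /H; case: (e k) => n [phi a] /=.
  have [m mS] := fdef_support dS.
  (* A fresh coordinate: outside the support of [S], invisible to [large], and not an argument of
     [phi]. *)
  pose j := maxn (maxn m m0) (\max_(i < n) a i).+1.
  pose S1 s := S s /\ ((exists x, sat phi (scons x (s \o a))) ->
                       sat phi (scons (s j) (s \o a))).
  have dS1 : fdef S1.
    apply: fdef_and => //; apply: fdef_imp.
      apply: fdef_ext (fdef_sat M (FImp (FAll (FImp phi (FBot L _))) (FBot L _)) a).
      move=> s /=; split=> [nA|[x px] /(_ x px) //].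
      by apply: contrapT => /forallNP /nA.
    pose b (i : 'I_n.+1) := if unlift ord0 i is Some i' then a i' else j.
    apply: fdef_ext (fdef_sat M phi b) => s; rewrite (@sat_ext _ _ _ _ _ (scons (s j) (s \o a))) //.
    by move=> i; rewrite /b /scons /=; case: unlift.
  have lS1 : large S1.
    apply: large_mono lS _ => s Ss.
    have [x xP] : exists x, (exists x, sat phi (scons x (s \o a))) ->
        sat phi (scons x (s \o a)).
      have [[x px]|np] := pselect (exists x, sat phi (scons x (s \o a))).
        by exists x.
      by exists (s 0%N) => /np.
    pose s' i := if i == j then x else s i.
    have s'E i : (i < j)%N -> s' i = s i by rewrite /s'; case: ltngtP.
    exists s'; last by move=> i im; apply: s'E; rewrite /j !leq_max im orbT.
    have s'a : s' \o a = s \o a.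
      by apply/funext => i; apply: s'E; rewrite /j leq_max ltnS (leq_bigmax i) orbT.
    split; last by rewrite s'a [s' j]/s' eqxx.
    by apply: mS Ss => i im; rewrite s'E // /j !leq_max im.
  have [S2 [dS2 lS2 S21 QS2]] := Q_dense k _ dS1 lS1.
  exists (exist _ S2 (conj dS2 lS2)) => /=; split=> //; first by move=> s /S21 [].
  by exists j => s /S21 [].
have dT : fdef (fun _ : nat -> M => True).
  apply: fdef_ext (fdef_not (fdef_false M)). by move=> s; split=> // _ [].
pose c := fix c k : cond :=
  if k is k'.+1 then projT1 (cid (step k' (c k'))) else exist _ _ (conj dT largeT).
have c_decr k l s : (k <= l)%N -> sval (c l) s -> sval (c k) s.
  move=> /subnK <-; elim: (l - k)%N => //= i IH.
  case: cid => S' /= [S'S _ _]. by move=> /S'S /IH.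
have exs k : exists s, sval (c k) s by apply: large_ex; exact: (svalP (c k)).2.
(* The conditions decrease, so whatever one of them forces holds eventually along [t], hence in the
   ultralimit. *)
pose t k := projT1 (cid (exs k)).
have tP k l : (k <= l)%N -> sval (c k) (t l).
  by move=> kl; apply: c_decr kl _; rewrite /t; case: cid.
have c_step k : Q k (sval (c k.+1)) /\ exists j, forall s, sval (c k.+1) s -> H (e k) j s.
  by rewrite /=; case: cid => S' /= [].
have [|N [h [h_surj Nnat MN los]]] := ultralimit (s := t) Minf.
  move=> n phi a; have [k ek] := eP n phi a.
  have [_ [j jP]] := c_step k; exists j, k.+1 => l kl.
  by have := jP _ (tP _ _ kl); rewrite /H ek.
exists N, h; split=> // k; have [Qk _] := c_step k.
exists (sval (c k.+1)) => // n phi a ca; apply: los.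
by exists k.+1 => l kl; apply/ca/tP.
Qed.

Lemma elementary_iso (L : language) (M N : structure L) (f : M -> N) :
  (forall y, exists x, f x = y) ->
  (forall n (phi : formula L n) (a : 'I_n -> M), sat phi a -> sat phi (f \o a)) ->
  isomorphism f.
Proof.
move=> f_surj fP.
have fE n (phi : formula L n) (a : 'I_n -> M) : sat phi (f \o a) -> sat phi a.
  move=> Nphi; apply: contrapT => nphi.
  exact: (fP _ (FImp phi (FBot L n)) a nphi Nphi).
have finj : injective f.
  move=> x y fxy; pose a (i : 'I_2) := if i == ord0 then x else y.
  exact: (fE _ (FEq (Var L (ord0 : 'I_2)) (Var L ord_max)) a).
split.
- pose g y := projT1 (cid (f_surj y)).
  have gK : cancel g f by move=> y; rewrite /g; case: cid.
  by exists g => // x; apply: finj; rewrite gK.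
- move=> k g a.
  have := fP _ (FEq (Var L ord0) (App g (fun i => Var L (lift ord0 i))))
    (scons (fint g a) a).
  have E (K : structure L) x (b : 'I_k -> K) : (fun i => scons x b (lift ord0 i)) = b.
    by apply/funext => i; rewrite /scons liftK.
  rewrite /= E /scons unlift_none => /(_ erefl) ->; congr fint.
  by apply/funext => i; rewrite liftK.
- move=> k R a; split; first exact: (fP _ (FRel R (fun i => Var L i)) a).
  exact: (fE _ (FRel R (fun i => Var L i)) a).
Qed.

Lemma iso_inv (L : language) (M N : structure L) (f : M -> N) (g : N -> M) :
  isomorphism f -> cancel f g -> cancel g f -> isomorphism g.
Proof.
move=> fi fK gK; apply: elementary_iso => [y|n phi a]; first by exists (f y).
rewrite -(iso_sat phi (g \o a) fi).
suff -> : f \o (g \o a) = a by [].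
by apply/funext => i /=; rewrite gK.
Qed.

(** * Isolated types, homogeneity and finitely many types of pairs *)

Section Categorical.
Variables (L : language) (M : structure L).
Hypotheses (cL : countable_language L) (Mcat : aleph0_categorical M).

Lemma categorical_enum : exists e : nat -> M, forall x, exists k, e k = x.
Proof.
have [/card_set_bijP [f [_ finj fsurj]] _] := Mcat.
have [//|x0 _ _] := fsurj 0%N.
by apply: (enum_surj x0 (f := f)) => x y; apply: finj; rewrite inE.
Qed.

Lemma categorical_infinite : infinite_set [set: M].
Proof. by apply/infiniteP; have [+ _] := Mcat; rewrite card_eq_le => /andP[]. Qed.

Lemma isolated_type n (t : 'I_n.+1 -> M) : exists2 chi : formula L n.+1,
  sat chi t & forall b : 'I_n.+1 -> M, sat chi b -> forall phi, sat phi t <-> sat phi b.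
Proof.
apply: contrapT => nonisolated.
have split_off (chi : formula L n.+1) : sat chi t -> exists (b : 'I_n.+1 -> M) phi,
    [/\ sat chi b, sat phi t & ~ sat phi b].
  move=> chit; apply: contrapT => nb; apply: nonisolated; exists chi => // b chib phi.
  split=> H; apply: contrapT => nH; apply: nb; exists b; first by exists phi.
  by exists (FImp phi (FBot L _)); split=> //=; apply.
have [e eP] : exists e : nat -> ('I_n.+1 -> nat), forall a, exists k, e k = a.
  apply: (@enum_surj _ {ffun 'I_n.+1 -> nat} (fun a => [ffun i => a i]) (fun=> 0%N)).
  by move=> a b /ffunP E; apply/funext => i; have := E i; rewrite !ffunE.
pose large (S : (nat -> M) -> Prop) := exists s, S s.
pose Q k (S : (nat -> M) -> Prop) := exists2 phi : formula L n.+1,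
  sat phi t & forall s, S s -> ~ sat phi (s \o e k).
have [||||N [h [h_surj Nnat MN los]]] := generic_model (m0 := 0) (large := large)
    (Q := Q) cL categorical_infinite.
- by have [x _] := categorical_enum; exists x.
- by [].
- by move=> S S' [s Ss] /(_ s Ss) [s' S's' _]; exists s'.
- move=> k S dS [s0 Ss0]; set a := e k.
  have [m mS] := fdef_support dS.
  pose p := maxn m (\max_(i < n.+1) a i).+1.
  (* [chi] defines the tuples that [S] allows at the indices [a]. All relevant coordinates are below
     [p]; they are quantified away after the tuple has been copied to the coordinates from [p]
     on. *)
  have [chi chiP] : exists chi : formula L n.+1, forall x,
      sat chi x <-> exists2 s, S s & s \o a = x.
    apply: fdef_formula.
    pose R (u : nat -> M) := S u /\ forall i : 'I_n.+1, u (a i) = u (p + i)%N.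
    have dR : fdef R.
      by apply: fdef_and => //; apply: fdef_forall_ord => i; apply: fdef_eq.
    have ja u s (i : 'I_n.+1) : join_assign p u s (a i) = u (a i).
      by rewrite /join_assign leq_max ltnS (leq_bigmax i) orbT.
    have jp u s (i : 'I_n.+1) : join_assign p u s (p + i)%N = s i.
      by rewrite /join_assign ltnNge leq_addr addKn.
    apply: fdef_ext (fdef_exs p dR) => s; split=> [[u [Su ua]]|[u Su us]].
      by exists (join_assign p u s) => //; apply/funext => i; rewrite /= ua jp.
    exists u; split=> [|i]; last by rewrite ja jp; exact: (congr1 (fun g => g i) us).
    by apply: mS Su => i im; rewrite /join_assign leq_max im.
  have [/split_off [b [phi [/chiP [s Ss sab] phit nphib]]]|nchit] := pselect (sat chi t).
    exists (fun s => S s /\ ~ sat phi (s \o a)); split=> [||? []//|].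
    + by apply: fdef_and => //; apply/fdef_not/fdef_sat.
    + by exists s; rewrite sab.
    + by exists phi => // ? [].
  exists S; split=> //; first by exists s0.
  exists (FImp chi (FBot L _)) => // s Ss /=; apply; apply/chiP.
  by exists s.
have [f fi] := Mcat.2 N MN Nnat.
have /choice [a aP] : forall i, exists j, h j = f (t i) by move=> i; exact: h_surj.
have [k ka] := eP a; have [S [phi phit Sphi] losS] := los k.
have /= : sat (FImp phi (FBot L _)) (h \o a).
  by apply: losS => s Ss /=; rewrite -ka; exact: Sphi.
have -> : h \o a = f \o t by apply/funext.
by apply; apply/(iso_sat _ _ fi).
Qed.

Let x0 : M := projT1 (cid (infinite_setN0 categorical_infinite)).
Let nthp p i := nth (x0, x0) p i.

(** Finite partial elementary maps, listed as pairs for the back-and-forth argument. *)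
Let elem (p : seq (M * M)) := forall n (phi : formula L n), (n <= size p)%N ->
  sat phi (fun i => (nthp p i).1) <-> sat phi (fun i => (nthp p i).2).

(** The forth step: that the tuple can be completed to a realization of the isolating formula [chi]
    is a first-order property, which passes from the first components to the second. *)
Let elem_rcons p c : elem p -> exists d, elem (rcons p (c, d)).
Proof.
move=> ep; set n := size p.
pose ext (b : 'I_n -> M) x (i : 'I_n.+1) := if unlift ord_max i is Some j then b j else x.
have extE (g : M * M -> M) q :
    (fun i : 'I_n.+1 => g (nthp (rcons p q) i)) = ext (fun i => g (nthp p i)) (g q).
  apply/funext => i; rewrite /nthp nth_rcons /ext.
  case: unliftP => [j ->|->]; first by rewrite lift_max ltn_ord.
  by rewrite /= ltnn eqxx.
have [chi chit chiP] := isolated_type (ext (fun i => (nthp p i).1) c).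
(* The new element comes last in the list, whereas a quantifier binds variable 0. *)
pose f (i : 'I_n.+1) : 'I_n.+1 := if unlift ord_max i is Some j then lift ord0 j else ord0.
have fP x (b : 'I_n -> M) : scons x b \o f = ext b x.
  apply/funext => i; rewrite /f /ext /scons /=.
  by case: (unliftP ord_max i) => [j _|_]; rewrite ?liftK ?unlift_none.
have psiP b : sat (FImp (FAll (FImp (rename chi f) (FBot L _))) (FBot L n)) b <->
    exists x, sat chi (ext b x).
  split=> /= [nA|[x cx] /(_ x)]; last by rewrite sat_rename fP => /(_ cx).
  by apply: contrapT => /forallNP N; apply: nA => x; rewrite sat_rename fP => /N.
have /psiP [d chid] : sat (FImp (FAll (FImp (rename chi f) (FBot L _))) (FBot L n))
    (fun i => (nthp p i).2).
  by apply/(ep _ _ (leqnn _)); apply/psiP; exists c.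
exists d => m phi; rewrite size_rcons => mn.
have := chiP _ chid (rename phi (widen_ord mn)).
rewrite !sat_rename -[in X in X -> _](extE fst (c, d)).
by rewrite -[in X in X -> _](extE snd (c, d)).
Qed.

Let elem_swap p : elem p -> elem [seq (q.2, q.1) | q <- p].
Proof.
move=> ep n phi; rewrite size_map => np.
have E (i : 'I_n) : nthp [seq (q.2, q.1) | q <- p] i = ((nthp p i).2, (nthp p i).1).
  by rewrite /nthp (nth_map (x0, x0)) // (leq_trans (ltn_ord i)).
have -> : (fun i : 'I_n => (nthp [seq (q.2, q.1) | q <- p] i).1) =
  fun i => (nthp p i).2 by apply/funext => i; rewrite E.
have -> : (fun i : 'I_n => (nthp [seq (q.2, q.1) | q <- p] i).2) =
  fun i => (nthp p i).1 by apply/funext => i; rewrite E.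
by rewrite ep.
Qed.

Let elem_rcons2 p d : elem p -> exists c, elem (rcons p (c, d)).
Proof.
move=> /elem_swap /(elem_rcons d) [c /elem_swap]; rewrite map_rcons -map_comp.
rewrite (@eq_map _ _ _ id) ?map_id; last by case.
by exists c.
Qed.

Lemma homogeneous n (a b : 'I_n -> M) :
  (forall phi : formula L n, sat phi a <-> sat phi b) ->
  exists2 f : M -> M, isomorphism f & forall i, f (a i) = b i.
Proof.
move=> ab; have [e eP] := categorical_enum.
pose part := {p | elem p}.
have step (p : part) k : exists q : part, exists c d,
    sval q = rcons (rcons (sval p) (e k, d)) (c, e k).
  case: p => p ep /=; have [d ed] := elem_rcons (e k) ep.
  by have [c ec] := elem_rcons2 (e k) ed; exists (exist _ _ ec), c, d.
pose p0 := [seq (a i, b i) | i <- enum 'I_n].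
have nth0 (i : 'I_n) : nthp p0 i = (a i, b i).
  by rewrite /nthp (nth_map i) ?size_enum_ord // nth_ord_enum.
have ep0 : elem p0.
  move=> m phi; rewrite size_map size_enum_ord => mn.
  have := ab (rename phi (widen_ord mn)); rewrite !sat_rename.
  have E (i : 'I_m) : nthp p0 i = (a (widen_ord mn i), b (widen_ord mn i)).
    by rewrite -nth0.
  have -> : (fun i : 'I_m => (nthp p0 i).1) = a \o widen_ord mn.
    by apply/funext => i; rewrite E.
  have -> // : (fun i : 'I_m => (nthp p0 i).2) = b \o widen_ord mn.
  by apply/funext => i; rewrite E.
pose c := fix c k : part :=
  if k is k'.+1 then projT1 (cid (step (c k') k')) else exist _ _ ep0.
have c_step k : exists x y, sval (c k.+1) = rcons (rcons (sval (c k)) (e k, y)) (x, e k).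
  by rewrite /=; case: cid.
pose G k i x y := (i < size (sval (c k)))%N /\ nthp (sval (c k)) i = (x, y).
have G_incr k l i x y : (k <= l)%N -> G k i x y -> G l i x y.
  move=> /subnK <-; elim: (l - k)%N => // m IH /IH [im Gm].
  have [u [v E]] := c_step (m + k)%N; split; rewrite addSn E.
    by rewrite !size_rcons ltnW // !ltnS ltnW.
  by rewrite /nthp !nth_rcons size_rcons ltnW ?im.
have dom x : exists y, exists k i, G k i x y.
  have [k ek] := eP x; have [u [v E]] := c_step k; exists v, k.+1, (size (sval (c k))).
  by rewrite /G E !size_rcons /nthp !nth_rcons size_rcons ltnS leqnn ltnn eqxx ek.
have cod y : exists x, exists k i, G k i x y.
  have [k ek] := eP y; have [u [v E]] := c_step k; exists u, k.+1, (size (sval (c k))).+1.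
  by rewrite /G E !size_rcons /nthp !nth_rcons size_rcons ltnn eqxx ek.
have GP m (phi : formula L m) (u v : 'I_m -> M) :
    (forall i, exists k j, G k j (u i) (v i)) -> sat phi u -> sat phi v.
  move=> /choice [k /choice [j H]] phiu.
  pose K := \max_(i < m) k i.
  have {}H i : G K (j i) (u i) (v i) by apply: G_incr (H i); exact: (leq_bigmax i).
  have := svalP (c K) _ (rename phi (fun i => Ordinal (H i).1)) (leqnn _).
  have E i : nthp (sval (c K)) (Ordinal (H i).1) = (u i, v i) := (H i).2.
  rewrite !sat_rename /comp.
  have -> : (fun i => (nthp (sval (c K)) (Ordinal (H i).1)).1) = u.
    by apply/funext => i; rewrite E.
  have -> : (fun i => (nthp (sval (c K)) (Ordinal (H i).1)).2) = v.
    by apply/funext => i; rewrite E.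
  by move=> <-.
have fun_G x y y' : (exists k i, G k i x y) -> (exists k i, G k i x y') -> y = y'.
  move=> Gy Gy'; pose u (i : 'I_2) := if i == ord0 then y else y'.
  apply: (GP _ (FEq (Var L (ord0 : 'I_2)) (Var L ord_max)) (fun=> x) u) => //.
  by move=> i; rewrite /u; case: ifP.
have /choice [f fG] := dom.
exists f.
  apply: elementary_iso => [y|m phi u]; last by apply: GP => i /=; exact: fG.
  by have [x Gx] := cod y; exists x; apply: fun_G Gx.
move=> i; apply: fun_G (fG _) _; exists 0%N, i; split; last exact: nth0.
by rewrite size_map size_enum_ord.
Qed.

Lemma same_type0_conj x y : same_type0 x y ->
  exists2 f : M -> M, isomorphism f & f x = y.
Proof.
move=> xy; have E (z : M) : scons z (noparam M) = fun=> z.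
  by apply/funext => i; rewrite /scons; case: unliftP => // -[].
have [phi|f fi fx] := @homogeneous 1 (fun=> x) (fun=> y).
  by have := xy phi; rewrite /defset /= !E.
by exists f => //; exact: (fx ord0).
Qed.

Let pair (q : M * M) (i : 'I_2) : M := if i == ord0 then q.1 else q.2.

Let pair_val (s : nat -> M) : s \o (fun i : 'I_2 => nat_of_ord i) = pair (s 0%N, s 1%N).
Proof. by apply/funext => -[[|[|//]] ?]. Qed.

(** Otherwise [M] realizes infinitely many 2-types. Then some model has, at coordinates 0 and 1, a
    pair of a type not realized in [M], although it is isomorphic to [M]. *)
Lemma pairs_conj (p : nat -> M * M) : exists m n, (m < n)%N /\
  exists2 f : M -> M, isomorphism f & f (p m).1 = (p n).1 /\ f (p m).2 = (p n).2.
Proof.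
apply: contrapT => np.
pose ty q := [set phi : formula L 2 | sat phi (pair q)].
have ty_conj m n : (m < n)%N -> ty (p m) <> ty (p n).
  move=> mn E; apply: np; exists m, n; split=> //.
  have [phi|f fi fP] := @homogeneous 2 (pair (p m)) (pair (p n)).
    by rewrite -[sat _ _]/(ty (p m) phi) E.
  by exists f => //; split; [exact: (fP ord0)|exact: (fP ord_max)].
have ty_inj : injective (ty \o p).
  by move=> m n E; case: (ltngtP m n) => // /ty_conj []; [exact: E|exact: esym E].
have [e eP] := categorical_enum.
have [q qP] : exists q : nat -> M * M, forall z, exists k, q k = z.
  exists (fun k => if unpickle k is Some (i, j) then (e i, e j) else (x0, x0)).
  move=> [x y]; have [i ei] := eP x; have [j ej] := eP y.
  by exists (pickle (i, j)); rewrite pickleK ei ej.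
(* Consistency means allowing infinitely many types at coordinates 0 and 1, the only ones it looks
   at; hence [m0 := 2]. *)
pose large (S : (nat -> M) -> Prop) :=
  infinite_set [set ty (s 0%N, s 1%N) | s in S].
pose Q k (S : (nat -> M) -> Prop) := exists2 chi : formula L 2,
  sat chi (pair (q k)) & forall s, S s -> ~ sat chi (pair (s 0%N, s 1%N)).
have [||||N [h [h_surj Nnat MN los]]] := generic_model (m0 := 2) (large := large)
    (Q := Q) cL categorical_infinite.
- apply: (@sub_infinite_set _ (range (ty \o p))).
    move=> _ [k _ <-]; exists (fun i => if i is 0%N then (p k).1 else (p k).2) => //=.
  apply/infiniteP; have : range (ty \o p) #= [set: nat].
    by apply: inj_card_eq => m n _ _; exact: ty_inj.
  by rewrite card_eq_le => /andP[].
- by move=> S /infinite_setN0 [_ [s Ss _]]; exists s.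
- move=> S S' lS SS'; apply: sub_infinite_set lS => _ [s /SS' [s' S's' E] <-].
  by exists s' => //; rewrite !E.
(* The type of [q k] is isolated, so excluding it removes just one type from [S]. *)
- move=> k S dS lS; have [chi chiq chiP] := isolated_type (pair (q k)).
  pose S' s := S s /\ ~ sat chi (pair (s 0%N, s 1%N)).
  exists S'; split=> [||s []//|]; last by exists chi => // s [].
    apply: fdef_and => //; apply: fdef_not; apply: fdef_ext (fdef_sat M chi (fun i => i)).
    by move=> s; rewrite pair_val.
  move=> fS'; apply: lS; apply: sub_finite_set (_ : finite_set
    ([set ty (s 0%N, s 1%N) | s in S'] `|` [set ty (q k)])).
    move=> _ [s Ss <-].
    have [chis|nchis] := pselect (sat chi (pair (s 0%N, s 1%N))); last by left; exists s.
    by right; apply/seteqP; split=> phi; rewrite /ty /=; have := chiP _ chis phi; case.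
  by rewrite finite_setU; split=> //; exact: finite_set1.
have [f fi] := Mcat.2 N MN Nnat.
have [[g fK gK] _ _] := fi.
have [k qk] := qP (g (h 0%N), g (h 1%N)); have [S [chi chiq Schi] losS] := los k.
have /= : sat (FImp chi (FBot L _)) (h \o (fun i : 'I_2 => nat_of_ord i)).
  by apply: losS => s Ss /=; rewrite pair_val; exact: Schi.
apply; have -> : h \o (fun i : 'I_2 => nat_of_ord i) = f \o pair (q k).
  apply/funext => i; rewrite /= qk; case: i => -[|[|//]] ? /=; by rewrite gK.
exact/(iso_sat _ _ fi).
Qed.

(* The imaginary required by [acl0_definable] is the parameter tuple modulo
   "defines the same set", restricted to the realizations of its type. *)
Lemma finite_conj_acl0 (X : set M) : definable X ->
  finite_set [set f @` X | f in [set f : M -> M | isomorphism f]] ->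
  acl0_definable X.
Proof.
move=> [n [phi0 [a0 XE]]] fin.
(* A dummy parameter is added, since [isolated_type] asks for a nonempty tuple. *)
have [phi [a {}XE]] : exists (phi : formula L n.+2) (a : 'I_n.+1 -> M), X = defset phi a.
  exists (rename phi0 (lift_renaming (lift ord0))), (scons x0 a0).
  rewrite XE; have E : scons x0 a0 \o lift ord0 = a0.
    by apply/funext => i; rewrite /scons /= liftK.
  by apply/seteqP; split=> x; rewrite /defset /= sat_rename scons_lift_renaming E.
have [chi chia chiP] := isolated_type a.
have [E EP] : exists E : formula L (n.+1 + n.+1),
  forall b : 'I_(n.+1 + n.+1) -> M,
    sat E b <-> defset phi (b \o lshift n.+1) = defset phi (b \o @rshift n.+1 n.+1).
  pose psi (f : 'I_n.+1 -> 'I_(n.+1 + n.+1)) := rename phi (lift_renaming f).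
  exists (FAll (FImp (FImp (FImp (psi (lshift n.+1)) (psi (@rshift n.+1 n.+1)))
    (FImp (FImp (psi (@rshift n.+1 n.+1)) (psi (lshift n.+1))) (FBot L _))) (FBot L _))) => b.
  split=> /= [H|H x].
    apply/seteqP; split=> x; have := H x; rewrite /psi !sat_rename !scons_lift_renaming /defset /=;
    move=> {}H Hx; apply: contrapT => nx; apply: H => H1 H2; exact: nx (_ Hx).
  rewrite /psi !sat_rename !scons_lift_renaming => H'.
  by move/seteqP: H => [H1 H2]; apply: H'; [exact: H1|exact: H2].
have EcatP (b c : 'I_n.+1 -> M) : sat E (env_cat b c) <-> defset phi b = defset phi c.
  have bE : env_cat b c \o lshift n.+1 = b.
    by apply/funext => i; rewrite /env_cat /= (unsplitK (inl i)).
  have cE : env_cat b c \o @rshift n.+1 n.+1 = c.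
    by apply/funext => i; rewrite /env_cat /= (unsplitK (inr i)).
  by rewrite EP bE cE.
exists n.+1, E, chi, phi, a; split=> //=.
- by split=> [b|b c|b c e]; rewrite !EcatP // => ->.
- split=> //.
  apply: sub_finite_set (finite_image (fun Y : set M => [set c | Y = defset phi c]) fin).
  move=> _ [b chib <-]; have [f fi fP] := homogeneous (chiP b chib).
  exists (f @` X); first by exists f.
  apply/seteqP; suff -> : f @` X = defset phi b by split=> c; rewrite /= EcatP.
  have ab x : scons (f x) b = f \o scons x a.
    by apply/funext => i; rewrite /scons /=; case: unlift => [j|//]; rewrite fP.
  rewrite XE; apply/seteqP; split=> [_ [x phix <-]|y phiy].
    by rewrite /defset /= ab iso_sat.
  have [[g _ gK] _ _] := fi; exists (g y); last exact: gK.
  by move: phiy; rewrite /defset /= -{1}(gK y) ab iso_sat.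
- by move=> b c; rewrite EcatP.
Qed.

End Categorical.

(** * The tree of a C-structure *)

Local Open Scope order_scope.
Local Open Scope classical_set_scope.

(** * Points of T(M)^* and their cones *)

Section StarTree.
Context {M : Type} {d : Order.disp_t} {T : meetSemilatticeType d}.
Variables (lf : M -> T) (g0 : M).
Hypotheses (Tgood : good_tree T) (lf_leaves : range lf = @is_leaf d T).

Local Notation S := (star T).
Local Notation l g := (of_tree (lf g) : S).
Implicit Types (x y z w : S) (g h a : M).

(** The cone at [x] that contains [y], where [y] may be a node; empty unless [x < y]. *)
Definition branch_cone x y : set M :=
  [set g | exists z, [/\ x < z, z <= y & z <= l g]].

Lemma starP x : (exists t, x = of_tree t) \/ (star_val x = None /\ ~ rooted T).
Proof.
case: x => [[t|] H]; first by left; exists t; apply: val_inj.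
by right; split=> //; move: H => /asboolPn.
Qed.

Lemma None_le x y : star_val x = None -> x <= y.
Proof. by rewrite /Order.le /= /star_le => ->. Qed.

Lemma of_tree_le (s t : T) : (of_tree s <= of_tree t :> S) = (s <= t).
Proof. by []. Qed.

Lemma of_tree_inj (s t : T) : of_tree s = of_tree t -> s = t.
Proof. by case. Qed.

Lemma of_tree_lt (s t : T) : (of_tree s < of_tree t :> S) = (s < t).
Proof.
rewrite !lt_def of_tree_le; by congr andb; congr negb.
Qed.

Lemma gt_tree x y : x < y -> exists t, y = of_tree t.
Proof.
move=> xy; have [//|[yN _]] := starP y.
by move: xy; rewrite lt_leAnge (None_le _ yN) andbF.
Qed.

Lemma star_chain x y z : x <= z -> y <= z -> x <= y \/ y <= x.
Proof.
have [[s ->]|[xN _]] := starP x; last by left; exact: None_le.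
have [[t ->]|[yN _]] := starP y; last by right; exact: None_le.
have [[u ->]|[zN _]] := starP z; last by rewrite /Order.le /= /star_le zN.
by have [chainT _ _] := Tgood; exact: chainT.
Qed.

Lemma star_meet x y : exists m, forall z, (z <= m) = (z <= x) && (z <= y).
Proof.
have [[s ->]|[xN _]] := starP x; last first.
  exists x => z; case: (boolP (z <= x)) => //= zx.
  by rewrite (le_trans zx (None_le _ xN)).
have [[t ->]|[yN _]] := starP y; last first.
  exists y => z; rewrite andbC; case: (boolP (z <= y)) => //= zy.
  by rewrite (le_trans zy (None_le _ yN)).
exists (of_tree (s `&` t)%O) => z.
have [[u ->]|[zN _]] := starP z; last by rewrite !None_le.
by rewrite !of_tree_le lexI.
Qed.

Lemma lf_leaf g : is_leaf (lf g).
Proof. by rewrite -lf_leaves; exists g. Qed.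

Lemma leaf_lf t : is_leaf t -> exists g, t = lf g.
Proof. by rewrite -lf_leaves => -[g _ <-]; exists g. Qed.

Lemma node_lf (t u : T) : t < u -> exists p q, p <> q /\ t = (lf p `&` lf q)%O.
Proof.
move=> tu; have [_ _ /(_ t) []] := Tgood.
  by move=> /(_ u (ltW tu)) E; rewrite E ltxx in tu.
move=> [a [b [/leaf_lf [p ->] /leaf_lf [q ->] pq ->]]].
by exists p, q; split=> // E; apply: pq; rewrite E.
Qed.

Lemma star_leaf x : exists g, x <= l g.
Proof.
have leafT t : exists g, t <= lf g.
  have [_ /(_ t) [a la ta] _] := Tgood.
  by have [g E] := leaf_lf la; exists g; rewrite -E.
have [[t ->]|[xN nr]] := starP x; first exact: leafT.
by exists g0; exact: None_le.
Qed.

(** A node is the meet of two leaves, which gives the case of [y] in the tree. If [y] is -oo, then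
    an [x] in the tree would be below all leaves, hence a root. So points are determined by their
    thick cones. *)
Lemma star_sep x y : (forall g, y <= l g -> x <= l g) -> x <= y.
Proof.
move=> H; have [[t E]|[yN _]] := starP y.
  have [_ _ /(_ t) []] := Tgood.
    by move=> /leaf_lf [g tg]; rewrite E tg; apply: H; rewrite E tg.
  move=> [a [b [/leaf_lf [p pE] /leaf_lf [q qE] _ tE]]].
  have xp : x <= l p by apply: H; rewrite E of_tree_le tE pE leIl.
  have xq : x <= l q by apply: H; rewrite E of_tree_le tE qE leIr.
  rewrite E tE pE qE; have [[s sE]|[xN _]] := starP x; last exact: None_le.
  by move: xp xq; rewrite sE !of_tree_le lexI => -> ->.
have [[s E]|[xN _]] := starP x; last exact: None_le.
have [_ nr] : star_val y = None /\ ~ rooted T by have [[t E']|//] := starP y; rewrite E' in yN.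
have sg g : s <= lf g by have := H g (None_le _ yN); rewrite E.
case: nr; exists s => u; have [chainT _ _] := Tgood.
have [g ug] := star_leaf (of_tree u); rewrite of_tree_le in ug.
have [//|us] := chainT _ _ _ (sg g) ug.
have [->//|nsu] := eqVneq u s.
have /node_lf [p [q [_ ->]]] : u < s by rewrite lt_neqAle nsu.
by rewrite lexI !sg.
Qed.

Lemma star_leaf_max x g : l g <= x -> x = l g.
Proof.
have [[t ->]|[xN _]] := starP x; last by rewrite /Order.le /= /star_le xN.
by rewrite of_tree_le => /lf_leaf ->.
Qed.

Lemma star_bot : exists o : S, forall x, o <= x.
Proof.
have [[r rP]|nr] := pselect (rooted T).
  exists (of_tree r) => x; have [[t ->]|[xN nr]] := starP x; first exact: rP.
  by case: nr; exists r.
have H : in_star (None : option T) by apply/asboolPn.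
by exists (Star H) => x; exact: None_le.
Qed.

(* A node is the basis of at least two cones, but -oo of exactly one: the second
   alternative is the case of -oo. *)
Lemma star_node x :
  (forall y, x < y -> exists2 g, x <= l g & ~ branch_cone x y g) \/
  (forall y, x < y -> (exists z, x < z < y) /\ forall g, branch_cone x y g) /\
    forall y, x <= y.
Proof.
have [[t ->]|[xN nr]] := starP x.
  left=> y ty; have [u E] := gt_tree ty; move: (ty); rewrite E of_tree_lt.
  move=> /node_lf [p [q [_ tE]]]; rewrite -E.
  have [Cp|nCp] := pselect (branch_cone (of_tree t) y p); last first.
    by exists p => //; rewrite of_tree_le tE leIl.
  exists q; first by rewrite of_tree_le tE leIr.
  move: Cp => [z1 [tz1 z1y z1p]] [z2 [tz2 z2y z2q]].
  have [z [tz zp zq]] : exists z : S, [/\ of_tree t < z, z <= l p & z <= l q].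
    have [z12|z21] := star_chain z1y z2y; [exists z1|exists z2]; split=> //.
      exact: le_trans z2q.
    exact: le_trans z1p.
  have [v vE] := gt_tree tz; move: tz zp zq; rewrite vE of_tree_lt !of_tree_le => tv vp vq.
  have vt : v <= t by rewrite tE lexI vp vq.
  by rewrite (lt_geF tv) in vt.
right; split; last by move=> y; exact: None_le.
have gtx (u : T) : x < of_tree u.
  rewrite lt_leAnge None_le //=; apply/negP.
  by rewrite /Order.le /= /star_le xN.
move=> y /gt_tree [u ->]; split=> [|g].
  have [w nuw] : exists w : T, ~ u <= w.
    by apply: contrapT => /forallNP H; apply: nr; exists u => w; apply: contrapT; exact: (H w).
  exists (of_tree (u `&` w)%O); rewrite gtx of_tree_lt lt_neqAle leIl andbT.
  by apply/eqP => E; apply: nuw; rewrite -E leIr.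
by exists (of_tree (u `&` lf g)%O); rewrite gtx !of_tree_le leIl leIr.
Qed.

Lemma cone_ofE x g : cone_of lf x g = branch_cone x (l g).
Proof.
apply/seteqP; split=> h => [xgh|[z [xz zg zh]]]; rewrite /cone_of /=.
  by exists (of_tree (lf g `&` lf h)%O); rewrite !of_tree_le leIl leIr.
apply: (lt_le_trans xz); have [u E] := gt_tree xz.
by move: zg zh; rewrite E !of_tree_le lexI => -> ->.
Qed.

Lemma branch_cone_le x y z : x < z -> z <= y -> branch_cone x y = branch_cone x z.
Proof.
move=> xz zy; apply/seteqP; split=> g [w [xw wy wg]]; last first.
  by exists w; split=> //; exact: le_trans zy.
have [wz|zw] := star_chain wy zy; [exists w|exists z]; split=> //.
exact: le_trans wg.
Qed.

Lemma branch_cone_eq x y g : x < y -> branch_cone x y g -> branch_cone x y = branch_cone x (l g).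
Proof.
by move=> xy [z [xz zy zg]]; rewrite (branch_cone_le xz zy) (branch_cone_le xz zg).
Qed.

Lemma thick_branch_cone x y g : x < y -> y <= l g -> branch_cone x y g.
Proof. by move=> xy yg; exists y. Qed.

Lemma glb_seq x (s : seq S) : x \in s ->
  exists m, forall w, w <= m <-> forall c, c \in s -> w <= c.
Proof.
case: s => // a s _; elim: s a => [|b s IH] a.
  by exists a => w; split=> [wa c|H]; rewrite ?inE; [move/eqP->|apply: H; rewrite inE].
have [m mP] := IH b; have [n nP] := star_meet a m.
exists n => w; rewrite nP; split=> [/andP[wa /mP wm] c|H].
  by rewrite inE => /predU1P[->//|]; exact: wm.
by rewrite H ?mem_head //=; apply/mP => c cs; apply: H; rewrite inE cs orbT.
Qed.
End StarTree.

(** * Leaves that a Boolean combination of cones cannot separate *)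

Section Combinations.
Context {M : Type} {d : Order.disp_t} {T : meetSemilatticeType d}.
Variables (lf : M -> T) (g0 : M).
Hypotheses (Tgood : good_tree T) (lf_leaves : range lf = @is_leaf d T).

Local Notation S := (star T).
Local Notation l g := (of_tree (lf g) : S).
Local Notation comb := (@comb M d T).
Implicit Types (x y z w c : S) (g h a : M) (e : comb).

Fixpoint base_seq e : seq S :=
  match e with
  | Cone x _ | Thick x => [:: x]
  | Union e1 e2 | Inter e1 e2 => base_seq e1 ++ base_seq e2
  | Compl e1 => base_seq e1
  end.

Fixpoint cone_points e : set M :=
  match e with
  | Cone _ a => [set a]
  | Thick _ => set0
  | Union e1 e2 | Inter e1 e2 => cone_points e1 `|` cone_points e2
  | Compl e1 => cone_points e1
  end.

Lemma base_seqP e c : (c \in base_seq e) <-> bases e c.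
Proof.
elim: e => [x a|x|e1 IH1 e2 IH2|e1 IH1 e2 IH2|e1 IH1] //=.
- by rewrite inE; split=> [/eqP|->].
- by rewrite inE; split=> [/eqP|->].
- by rewrite mem_cat; split=> [/orP[/IH1|/IH2]|[/IH1|/IH2] ->]; rewrite ?orbT; [left|right|..].
- by rewrite mem_cat; split=> [/orP[/IH1|/IH2]|[/IH1|/IH2] ->]; rewrite ?orbT; [left|right|..].
Qed.

Lemma finite_cone_points e : finite_set (cone_points e).
Proof.
by elim: e => //= e1 IH1 e2 IH2; rewrite finite_setU.
Qed.

Lemma thick_below c x g h : ~ x <= c -> x <= l g -> x <= l h ->
  c <= l g -> c <= l h.
Proof.
move=> nxc xg xh cg; have [cx|//] := star_chain Tgood cg xg.
exact: le_trans xh.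
Qed.

Lemma cone_below c x a g h : ~ x <= c -> x <= l g -> x <= l h ->
  branch_cone lf c (l a) g -> branch_cone lf c (l a) h.
Proof.
move=> nxc xg xh [z [cz za zg]].
have [zx|xz] := star_chain Tgood zg xg.
  by exists z; split=> //; exact: le_trans xh.
exists x; split=> //; last exact: le_trans za.
have [cx|//] := star_chain Tgood (le_trans (ltW cz) zg) xg.
by rewrite lt_neqAle cx andbT; apply/eqP => E; apply: nxc; rewrite E.
Qed.

(** A cone or thick cone whose basis is not above [x] contains all leaves above [x] or none; one
    whose basis is above [x] contains neither [g] nor [h], by hypothesis. *)
Lemma comb_set_thick e x g h : x <= l g -> x <= l h ->
  (forall c, bases e c -> x <= c -> ~ c <= l g /\ ~ c <= l h) ->
  comb_set lf e g -> comb_set lf e h.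
Proof.
move: g h; suff H g h : x <= l g -> x <= l h ->
  (forall c, bases e c -> x <= c -> ~ c <= l g /\ ~ c <= l h) ->
  comb_set lf e g <-> comb_set lf e h by move=> g h xg xh B /(H _ _ xg xh B).
move=> xg xh; elim: e => [c a|c|e1 IH1 e2 IH2|e1 IH1 e2 IH2|e1 IH1] B /=.
- rewrite !cone_ofE //; have [xc|nxc] := pselect (x <= c).
    have [ncg nch] := B c erefl xc.
    by split=> -[z [cz _ zg]]; [case: ncg|case: nch]; exact: le_trans (ltW cz) zg.
  by split; [exact: cone_below nxc xg xh|exact: cone_below nxc xh xg].
- rewrite /thick_cone /=; have [xc|nxc] := pselect (x <= c).
    by have [ncg nch] := B c erefl xc; split=> /= cg; [case: ncg|case: nch].
  by split; [exact: thick_below nxc xg xh|exact: thick_below nxc xh xg].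
- by rewrite /setU /= IH1 ?IH2 // => c ec; apply: B; [right|left].
- by rewrite /setI /= IH1 ?IH2 // => c ec; apply: B; [right|left].
- by rewrite /setC /= IH1.
Qed.

(** Here [x] itself may be a basis: its thick cone contains both leaves, and the cones at [x]
    occurring in [e] contain neither, by the assumption on [cone_points]. *)
Lemma comb_set_cone e x g h : x < l g -> x < l h ->
  (forall a, cone_points e a -> ~ branch_cone lf x (l a) g /\ ~ branch_cone lf x (l a) h) ->
  (forall c, bases e c -> x < c -> ~ branch_cone lf x c g /\ ~ branch_cone lf x c h) ->
  comb_set lf e g -> comb_set lf e h.
Proof.
move: g h; suff H g h : x < l g -> x < l h ->
  (forall a, cone_points e a -> ~ branch_cone lf x (l a) g /\ ~ branch_cone lf x (l a) h) ->
  (forall c, bases e c -> x < c -> ~ branch_cone lf x c g /\ ~ branch_cone lf x c h) ->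
  comb_set lf e g <-> comb_set lf e h by move=> g h xg xh A B /(H _ _ xg xh A B).
move=> xg xh; elim: e => [c a|c|e1 IH1 e2 IH2|e1 IH1 e2 IH2|e1 IH1] A B /=.
- rewrite !cone_ofE //; have [xc|nxc] := pselect (x <= c); last first.
    by split; apply: cone_below nxc _ _; exact: ltW.
  have [cx|nxx] := eqVneq c x; first by rewrite cx; have [] := A a erefl.
  have {nxx}xc : x < c by rewrite lt_neqAle xc eq_sym nxx.
  have [ncg nch] := B c erefl xc.
  by split=> -[z [cz _ zg]]; [case: ncg|case: nch]; exists c; split=> //;
     exact: le_trans (ltW cz) zg.
- rewrite /thick_cone /=; have [xc|nxc] := pselect (x <= c); last first.
    by split; apply: thick_below nxc _ _; exact: ltW.
  have [->|nxx] := eqVneq c x; first by rewrite !ltW.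
  have {nxx}xc : x < c by rewrite lt_neqAle xc eq_sym nxx.
  have [ncg nch] := B c erefl xc.
  by split=> cg; [case: ncg|case: nch]; exact: thick_branch_cone.
- by rewrite /setU /= IH1 ?IH2 // => c ec; [apply: A|apply: B|apply: A|apply: B];
     by [right|left].
- by rewrite /setI /= IH1 ?IH2 // => c ec; [apply: A|apply: B|apply: A|apply: B];
     by [right|left].
- by rewrite /setC /= IH1.
Qed.
End Combinations.

(** * The finite label given by the bases *)

Section Keys.
Context {d : Order.disp_t} {T : meetSemilatticeType d}.
Local Notation S := (star T).
Implicit Types (x y z w c : S).
Variable D : seq S.

(* The set of bases above a point: a finite invariant, constant on the
   homogeneous pieces of each branch. *)
Definition key x : {set 'I_(size D)} := [set k | x <= tnth (in_tuple D) k]%SET.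

Lemma keyP x c : c \in D -> exists k, forall y, (k \in key y) = (y <= c).
Proof.
move=> /(tnthP (in_tuple D)) [k ->].
by exists k => y; rewrite inE.
Qed.

Lemma key_eqP x y : key x = key y <-> forall c, c \in D -> (x <= c) = (y <= c).
Proof.
split=> [E c /(keyP x) [k kP]|H]; first by rewrite -!kP E.
by apply/setP => k; rewrite !inE H // mem_tnth.
Qed.

Lemma key_sub x y : x <= y -> key y \subset key x.
Proof. by move=> xy; apply/fintype.subsetP => k; rewrite !inE; exact: le_trans. Qed.

(** Keys shrink upwards, so a point whose key has least cardinality will do. *)
Lemma key_up (Z : set S) : Z !=set0 ->
  exists2 z0, Z z0 & forall z, Z z -> z0 <= z -> key z = key z0.
Proof.
move=> [z1 Zz1].
have ex : exists n, `[< exists2 z, Z z & #|key z| = n >].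
  by exists #|key z1|; apply/asboolP; exists z1.
case: (ex_minnP ex) => n /asboolP [z0 Zz0 kz0] nmin.
exists z0 => // z Zz z0z; apply/eqP; rewrite eqEcard key_sub //= kz0.
by apply: nmin; apply/asboolP; exists z.
Qed.

Lemma key_down (Z : set S) : Z !=set0 ->
  exists2 z0, Z z0 & forall z, Z z -> z <= z0 -> key z = key z0.
Proof.
move=> [z1 Zz1].
have ex : exists n, `[< exists2 z, Z z & #|key z| = n >].
  by exists #|key z1|; apply/asboolP; exists z1.
have bd n : `[< exists2 z, Z z & #|key z| = n >] -> (n <= size D)%N.
  by move=> /asboolP [z _ <-]; rewrite -[leqRHS]card_ord max_card.
case: (ex_maxnP ex bd) => n /asboolP [z0 Zz0 kz0] nmax.
exists z0 => // z Zz zz0; apply/esym/eqP; rewrite eqEcard key_sub //= kz0.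
by apply: nmax; apply/asboolP; exists z.
Qed.
End Keys.

(** * The partition as a colouring of the leaves *)

Section ColoredTree.
Context {M : Type} {d : Order.disp_t} {T : meetSemilatticeType d}.
Variables (lf : M -> T) (g0 : M).
Hypotheses (Tgood : good_tree T) (lf_leaves : range lf = @is_leaf d T).
Variables (r : nat) (P : 'I_r -> set M) (e : 'I_r -> @comb M d T).
Hypotheses (P_disj : forall i j g, P i g -> P j g -> i = j)
  (P_cover : forall g, exists i, P i g)
  (P_comb : forall i, comb_set lf (e i) = P i).

Local Notation S := (star T).
Local Notation l g := (of_tree (lf g) : S).
Local Notation Cn := (thick_cone lf).
Local Notation bc := (branch_cone lf).
Local Notation Theta1 := (Theta1 lf P e).
Local Notation rest := (Theta1_rest lf P e).
Local Notation side := (side lf P e).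
Local Notation branch := (Theta1_branch lf P e).
Implicit Types (x y z w c v u : S) (g h a : M) (i j : 'I_r).

Let leaf_above := star_leaf g0 Tgood lf_leaves.
Let chain := star_chain Tgood.
Let meet := @star_meet d T.

(** This is Theta1 in a form that does not mention the combinations [e]; see [Theta1E]. *)
Definition multicolored x : Prop := ~ exists i, Cn x `<=` P i.

Definition all_bases : seq S := flatten [seq base_seq (e i) | i <- enum 'I_r].

Local Notation key := (key all_bases).

Lemma all_basesP c : c \in all_bases <-> exists i, bases (e i) c.
Proof.
split=> [/flatten_mapP [i _ /base_seqP ?]|[i /base_seqP ec]]; first by exists i.
by apply/flatten_mapP; exists i; rewrite ?mem_enum.
Qed.

Lemma multicolored_down x y : x <= y -> multicolored y -> multicolored x.
Proof.
move=> xy my [i xP]; apply: my; exists i => g yg.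
by apply: xP; exact: le_trans yg.
Qed.

Lemma multicolored_two x : multicolored x ->
  exists i j a b, [/\ i <> j, P i a, P j b, x <= l a & x <= l b].
Proof.
move=> mx; have [a xa] := leaf_above x; have [i Pa] := P_cover a.
have /existsNP [b /not_implyP [xb nPb]] : ~ Cn x `<=` P i by move=> H; apply: mx; exists i.
have [j Pb] := P_cover b; exists i, j, a, b; split=> //.
by move=> ij; apply: nPb; rewrite ij.
Qed.

Lemma two_multicolored x i j a b :
  i <> j -> P i a -> P j b -> x <= l a -> x <= l b -> multicolored x.
Proof.
move=> ij Pa Pb xa xb [k kP]; apply: ij.
by rewrite (P_disj Pa (kP a xa)) (P_disj Pb (kP b xb)).
Qed.

Lemma multicolored_base x : multicolored x -> exists2 c, c \in all_bases & x <= c.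
Proof.
move=> mx; apply: contrapT => nc.
have [i [j [a [b [ij Pa Pb xa xb]]]]] := multicolored_two mx.
apply: ij; apply: (@P_disj _ _ b) => //; rewrite -P_comb.
apply: comb_set_thick xa xb _ _ => //; last by rewrite P_comb.
by move=> c ec xc; case: nc; exists c => //; apply/all_basesP; exists i.
Qed.

(** As the keys agree, a base above [x] is above [y], hence not below a leaf that branches off
    between [x] and [y]. No [e i] can then separate two such leaves. *)
Lemma gap x y g h i : x < y -> key x = key y -> x <= l g -> ~ y <= l g ->
  x <= l h -> ~ y <= l h -> P i g -> P i h.
Proof.
move=> xy /key_eqP kxy xg nyg xh nyh; rewrite -!P_comb.
apply: comb_set_thick xg xh _ => // c ec.
rewrite kxy; last by apply/all_basesP; exists i.
by move=> yc; split=> H; [apply: nyg|apply: nyh]; exact: le_trans H.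
Qed.

(* For [x] in [Theta1_rest] this is [side x `<=` P i], phrased without the sets
   U, B, S so that it is visibly preserved by automorphisms. *)
Definition sided i x : Prop :=
  exists y, [/\ multicolored y, x < y & Cn x `\` bc x y `<=` P i].

Lemma sided_multicolored i x : sided i x -> multicolored x.
Proof. by move=> [y [my xy _]]; exact: multicolored_down (ltW xy) my. Qed.

(** A sided point is not a branching point of Theta1: a multicolored point in another cone would
    have its thick cone inside the one-coloured side. *)
Lemma sided_meet i x y1 y2 : sided i x -> multicolored y1 -> multicolored y2 ->
  x < y1 -> x < y2 -> exists z, [/\ x < z, z <= y1 & z <= y2].
Proof.
move=> [y [my xy yP]].
have half y' : multicolored y' -> x < y' -> exists z, [/\ x < z, z <= y & z <= y'].
  move=> my' xy'; apply: contrapT => nz; apply: my'; exists i => g y'g.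
  apply: yP; split; first exact: le_trans (ltW xy') y'g.
  move=> [z [xz zy zg]]; apply: nz; have [zy'|y'z] := chain zg y'g.
    by exists z.
  by exists y'; split=> //; exact: le_trans zy.
move=> my1 my2 /(half _ my1) [z1 [xz1 z1y z1y1]] /(half _ my2) [z2 [xz2 z2y z2y2]].
have [z12|z21] := chain z1y z2y; [exists z1|exists z2]; split=> //.
  exact: le_trans z2y2.
exact: le_trans z1y1.
Qed.

Lemma sided_cone i x y : sided i x -> multicolored y -> x < y ->
  Cn x `\` bc x y `<=` P i.
Proof.
move=> sx my xy; have [y' [my' xy' yP]] := sx.
have [z [xz zy zy']] := sided_meet sx my my' xy xy'.
by rewrite (branch_cone_le lf Tgood xz zy) -(branch_cone_le lf Tgood xz zy').
Qed.

Lemma key_sided x y g i : x < y -> key x = key y -> multicolored y ->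
  x <= l g -> ~ y <= l g -> P i g -> sided i x.
Proof.
move=> xy kxy my xg nyg Pg; exists y; split=> // h [xh nbh].
apply: gap xg nyg xh _ Pg => // yh; apply: nbh; exact: thick_branch_cone.
Qed.

(** An equivalence relation on the points that are [sided i]; its classes are the maximal intervals
    from which I is formed. *)
Definition convex i x y : Prop :=
  (x <= y \/ y <= x) /\ forall v, x <= v <= y \/ y <= v <= x -> sided i v.

Lemma convex_refl i x : sided i x -> convex i x x.
Proof.
move=> sx; split=> [|v vx]; first by left.
by have -> : v = x by case: vx => /le_anti ->.
Qed.

Lemma convex_sym i x y : convex i x y -> convex i y x.
Proof.
by move=> [xy H]; split=> [|v vx]; [case: xy; [right|left]|apply: H; case: vx; [right|left]].
Qed.

Lemma convex_r i x y : convex i x y -> sided i y.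
Proof. by move=> [[xy|yx]]; apply; [left|right]; rewrite lexx ?andbT. Qed.

Lemma convex_l i x y : convex i x y -> sided i x.
Proof. by move=> /convex_sym /convex_r. Qed.

Lemma convex_between i x y v :
  convex i x y -> (x <= v <= y \/ y <= v <= x) -> convex i x v.
Proof.
move=> [_ H] [] /andP[v1 v2]; split.
- by left.
- move=> w [] /andP[w1 w2]; apply: H; left; first by rewrite w1 (le_trans w2).
  by rewrite (le_trans v1 w1) (le_trans w2) // (le_trans v1).
- by right.
- move=> w [] /andP[w1 w2]; apply: H; right; last by rewrite (le_trans v1).
  by rewrite (le_trans w2 v2) (le_trans v1) // (le_trans v2).
Qed.

Lemma convex_trans i x y z : convex i x y -> convex i y z -> convex i x z.
Proof.
have up x' y' z' : x' <= y' -> y' <= z' -> convex i x' y' -> convex i y' z' ->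
    convex i x' z'.
  move=> xy yz [_ H1] [_ H2]; split=> [|v]; first by left; exact: le_trans yz.
  case=> /andP[v1 v2].
    have [vy|yv] := chain v2 yz; [apply: H1|apply: H2]; left; first by rewrite v1.
    by rewrite yv.
  apply: H1; left; rewrite (le_trans v2 xy) andbT.
  exact: le_trans xy (le_trans yz v1).
move=> cxy cyz; have [[xy|yx] H1] := cxy; have [[yz|zy] H2] := cyz.
- exact: up cxy cyz.
- split=> [|v]; first exact: chain xy zy.
  by case=> /andP[v1 v2]; [apply: H1|apply: H2];
     [left|right]; rewrite v1 ?(le_trans v2).
- have mx := sided_multicolored (convex_l cxy).
  have xz : x <= z \/ z <= x.
    (* The meet is between [y] and [x], hence sided; were it different from both [x] and [z], Theta1
       would branch there. *)
    have [m mP] := meet x z.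
    have /andP[m_x m_z] : (m <= x) && (m <= z) by rewrite -mP.
    have [<-|nmx] := eqVneq m x; first by left.
    have [<-|nmz] := eqVneq m z; first by right.
    have sm : sided i m by apply: H1; right; rewrite mP yx yz.
    have [||w [mw wx wz]] := sided_meet sm (sided_multicolored (convex_l cxy))
      (sided_multicolored (convex_r cyz)); rewrite ?lt_neqAle ?nmx ?nmz //.
    have : w <= m by rewrite mP wx.
    by rewrite (lt_geF mw).
  split=> // v; case=> /andP[v1 v2]; [apply: H2; left|apply: H1; right].
    by rewrite v2 (le_trans yx v1).
  by rewrite v2 (le_trans yz v1).
- by apply/convex_sym; apply: up (zy) (yx) _ _; apply/convex_sym.
Qed.

(** * Theta1, its branches and the sets U, B, S, I *)

Lemma Theta1E x : Theta1 x <-> multicolored x.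
Proof.
split=> [[_ [i [j [a [b [ij Pa Pb xa xb]]]]]]|mx].
  exact: two_multicolored ij Pa Pb xa xb.
split; last exact: multicolored_two.
by have [c /all_basesP [i ec] xc] := multicolored_base mx; exists i, c.
Qed.

Lemma branch_multicolored b x : branch b -> b x -> multicolored x.
Proof. by move=> [[bT _] _] /bT /Theta1E. Qed.

Lemma branch_total b x y : branch b -> b x -> b y -> x <= y \/ y <= x.
Proof. by move=> [[_ bch] _]; exact: bch. Qed.

Lemma branch_extend b v : branch b -> multicolored v ->
  (forall w, b w -> w <= v \/ v <= w) -> b v.
Proof.
move=> bb mv vP; have [[bT bch] bmax] := bb.
suff <- : b `|` [set v] = b by right.
apply: bmax; last by left.
split=> [x [/bT//|->]|x y [bx|->] [yb|->]]; first exact/Theta1E.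
- exact: bch.
- exact: vP.
- by have [|] := vP y yb; [right|left].
- by left.
Qed.

Lemma branch_down b v w : branch b -> b w -> v <= w -> b v.
Proof.
move=> bb bw vw; apply: branch_extend => //.
  exact: multicolored_down vw (branch_multicolored bb bw).
move=> u bu; have [uw|wu] := branch_total bb bu bw; first exact: chain uw vw.
by right; exact: le_trans wu.
Qed.

Lemma below_branch x : multicolored x ->
  (forall y, multicolored y -> x <= y -> y = x) -> branch [set z | z <= x].
Proof.
move=> mx xmax; split.
  split=> [z zx|y z yx zx]; last exact: chain yx zx.
  by apply/Theta1E; exact: multicolored_down zx mx.
move=> B [BT Bch] xB; apply/seteqP; split=> // y By.
have [|xy] := Bch y x By (xB x (lexx x)); first by [].
by rewrite /= (xmax y) //; apply/Theta1E/BT.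
Qed.

Lemma ThetaU_max x : multicolored x ->
  (forall y, multicolored y -> x <= y -> y = x) -> ThetaU lf P e x.
Proof.
move=> mx xmax; exists [set z | z <= x]; first exact: below_branch.
by split=> [z|z zub] //; apply: zub; exact: lexx.
Qed.

(** The points below [u] form a branch: a point comparable with all of them is below or above [u],
    and nothing above [u] is multicolored. If [u] is the least point, this is the empty branch. *)
Lemma ThetaU_sup u : ~ multicolored u -> (forall z, z < u -> multicolored z) ->
  (forall z, z < u -> exists2 z', z < z' & z' < u) -> ThetaU lf P e u.
Proof.
move=> nmu lu nou.
have below y : (forall z, z < u -> y <= z \/ z <= y) -> y < u \/ u <= y.
  move=> yP; have [m mP] := meet y u.
  have /andP[m_y m_u] : (m <= y) && (m <= u) by rewrite -mP.
  have [E|nmu'] := eqVneq m u; first by right; rewrite -E.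
  have /nou [z mz zu] : m < u by rewrite lt_neqAle nmu'.
  have [yz|zy] := yP z zu; first by left; exact: le_lt_trans zu.
  have : z <= m by rewrite mP zy ltW.
  by rewrite (lt_geF mz).
exists [set z | z < u]; last first.
  split=> [z /ltW //|w wub]; have [z zu|wu|//] := below w.
    by right; exact: wub.
  by have [z wz /wub] := nou w wu; rewrite (lt_geF wz).
split.
  split=> [z zu|y z /ltW yu /ltW zu]; last exact: chain yu zu.
  by apply/Theta1E; exact: lu.
move=> B [BT Bch] uB; apply/seteqP; split=> // y By.
have [z zu|//|uy] := below y; first by apply: Bch => //; exact: uB.
by case: nmu; apply: multicolored_down uy _; apply/Theta1E/BT.
Qed.

Lemma ThetaU_maximal x y : ThetaU lf P e x -> multicolored y -> ~ x < y.
Proof.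
move=> [b bb [xub _]] my xy.
have: y <= x.
  apply: (xub); apply: branch_extend => // w bw.
  by left; exact: le_trans (xub w bw) (ltW xy).
by rewrite (lt_geF xy).
Qed.

Lemma sided_rest i x : sided i x -> rest x /\ side x `<=` P i.
Proof.
move=> sx; have mx := sided_multicolored sx; have [y [my xy yP]] := sx.
have sP : side x `<=` P i.
  move=> g [xg ng]; apply: yP; split=> // -[z [xz zy zg]]; apply: ng.
  have [t E] := gt_tree xz; exists t; rewrite -E; split=> //.
    by apply/Theta1E; exact: multicolored_down zy my.
  by have /= := xz; rewrite E; move: zg; rewrite E of_tree_le => /meet_l ->.
split=> //; split; first exact/Theta1E.
move=> [[xU|[s [t [/Theta1E ms /Theta1E mt xE xs xt]]]]|[_ [j [k [jk]]]]].
- exact: ThetaU_maximal xU my xy.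
- have [z [xz zs zt]] := sided_meet sx ms mt xs xt.
  have [u E] := gt_tree xz; move: xz zs zt; rewrite E xE of_tree_lt !of_tree_le => xu us ut.
  have : u <= (s `&` t)%O by rewrite lexI us.
  by rewrite (lt_geF xu).
- move=> [g [/sP Pg Pjg]] [h [/sP Ph Pkh]]; apply: jk.
  by rewrite -(P_disj Pg Pjg) -(P_disj Ph Pkh).
Qed.

(** Outside U there is a multicolored point above [x]; outside B all such points share one cone at
    [x], so [side x] contains the rest of the thick cone. *)
Lemma rest_cone x : rest x -> exists y, [/\ multicolored y, x < y &
  Cn x `\` bc x y `<=` side x].
Proof.
move=> [/Theta1E mx nUBS].
have [y my xy] : exists2 y, multicolored y & x < y.
  apply: contrapT => ny; apply: nUBS; left; left; apply: ThetaU_max => // y my xy.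
  apply: contrapT => nyx; apply: ny; exists y => //.
  by rewrite lt_neqAle xy andbT; apply/eqP => E; apply: nyx.
exists y; split=> // g [xg nbg]; split=> // -[t [/Theta1E mt xt xtg]].
apply: nUBS; left; right; have [s yE] := gt_tree xy.
exists s, t; rewrite -yE; split=> //; [exact/Theta1E|exact/Theta1E|].
have [//|nx] := eqVneq x (of_tree (s `&` t)%O); case: nbg.
have xst : x < of_tree (s `&` t)%O.
  rewrite lt_neqAle nx /=; have [m mP] := meet (of_tree s) (of_tree t).
  have [[q xE]|[xN _]] := starP x; last exact: None_le.
  by move: (ltW xy) (ltW xt); rewrite yE xE !of_tree_le lexI => -> ->.
have tg : of_tree (t `&` lf g)%O <= l g by rewrite of_tree_le leIr.
have tt : of_tree (t `&` lf g)%O <= of_tree t :> S by rewrite of_tree_le leIl.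
have stt : of_tree (s `&` t)%O <= of_tree t :> S by rewrite of_tree_le leIr.
have sty : of_tree (s `&` t)%O <= y :> S by rewrite yE of_tree_le leIl.
have [c1|c2] := chain tt stt.
  by exists (of_tree (t `&` lf g)%O); split=> //; exact: le_trans sty.
by exists (of_tree (s `&` t)%O); split=> //; exact: le_trans tg.
Qed.

Lemma rest_side_sided i x : rest x -> side x `<=` P i -> sided i x.
Proof.
move=> /rest_cone [y [my xy yP]] sP; exists y; split=> //.
exact: subset_trans sP.
Qed.

Lemma rest_sided x : rest x -> exists i, sided i x.
Proof.
move=> rx; have [mx nUBS] := rx.
suff [i sP] : exists i, side x `<=` P i by exists i; exact: rest_side_sided.
(* The side may be empty, at -oo; any colour will do then. *)
have [[g sg]|s0] := pselect (side x !=set0); last first.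
  have [i _] := P_cover g0; exists i => g sg; case: s0; by exists g.
have [i Pg] := P_cover g; exists i => h sh.
have [j Ph] := P_cover h; have [<-//|ij] := eqVneq j i.
case: nUBS; right; split; last by exists i, j; split;
  [move=> E; rewrite E eqxx in ij|exists g|exists h].
by split=> // UB; case: rx => _; apply; left.
Qed.

Lemma branch_exists (J : set S) : J `<=` multicolored ->
  (forall x y, J x -> J y -> x <= y \/ y <= x) -> exists2 b, branch b & J `<=` b.
Proof.
move=> Jm Jc.
(* Zorn's lemma is applied to what is added to [J], so that the empty union causes no problem. *)
pose Q (X : set S) := (J `|` X) `<=` multicolored /\
  forall x y, (J `|` X) x -> (J `|` X) y -> x <= y \/ y <= x.
have [F FQ Ftot|A [[Am Ac] Amax]] := @Zorn_bigcup _ Q.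
  split=> [x [/Jm//|[X FX Xx]]|x y]; first by apply: (FQ X FX).1; right.
  move=> [Jx|[X FX Xx]] [Jy|[Y FY Yy]].
  - exact: Jc.
  - by apply: (FQ Y FY).2; [left|right].
  - by apply: (FQ X FX).2; [right|left].
  - have [XY|YX] := Ftot X Y FX FY.
      by apply: (FQ Y FY).2; right => //; exact: XY.
    by apply: (FQ X FX).2; right => //; exact: YX.
exists (J `|` A); last by left.
split; first by split=> // x /Am /Theta1E.
move=> B [Bm Bc] JAB; apply: contrapT => nE; apply: (Amax B).
  split; first by move=> x Ax; apply: JAB; right.
  by move=> BA; apply: nE; apply/seteqP; split=> // x /BA; right.
have JB : J `|` B = B by apply/setUidPr => x Jx; apply: JAB; left.
by rewrite /Q JB; split=> [x /Bm /Theta1E|x y]; [|exact: Bc].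
Qed.

(** A larger admissible interval is a chain of [sided i] points through [x] without gaps on its
    branch, so it is contained in the class of [x]. *)
Lemma ThetaI_inf i x c : sided i x -> rest c -> infimums (convex i x) c ->
  ThetaI lf P e c.
Proof.
move=> sx rc Jc; split=> //; exists i, (convex i x); split=> //; split.
  split; last by move=> z /convex_r /sided_rest.
  split; first by exists x; exact: convex_refl.
  have [||b bb Jb] := @branch_exists (convex i x).
  - by move=> z /convex_r /sided_multicolored.
  - by move=> y z /convex_sym xy xz; have [] := convex_trans xy xz.
  exists b => //; split=> // y z w xy xz _ ywz.
  apply: convex_trans (xy) _.
  by apply: convex_between (convex_trans (convex_sym xy) xz) _; left.
move=> B [[B0 [b bb [Bb Bconv]]] BP] JB; apply/seteqP; split=> // z Bz.
have Bx : B x by apply: JB; exact: convex_refl.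
split; first exact: branch_total (Bb x Bx) (Bb z Bz).
have BG v : B v -> sided i v by move=> /BP [] ; exact: rest_side_sided.
move=> v []; move=> /[dup] vv /andP[v1 v2]; apply: BG.
  by apply: (Bconv x z) => //; exact: branch_down (Bb z Bz) v2.
by apply: (Bconv z x) => //; exact: branch_down (Bb x Bx) v2.
Qed.

(** * Automorphisms and definable sets, reduced to what the tree argument uses *)

Variables (Aut : set (M -> M)) (Def : set M -> Prop).
Hypotheses (lf_inj : injective lf)
  (Aut_tree : forall f, Aut f -> exists t : S -> S,
     bijective t /\ forall x g, (t x <= l (f g)) = (x <= l g))
  (Aut_surj : forall f, Aut f -> forall h, exists g, f g = h)
  (Aut_P : forall f i g, Aut f -> P i (f g) <-> P i g)
  (Aut_trans : forall i g h, P i g -> P i h -> exists2 f, Aut f & f g = h)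
  (Aut_pairs : forall p : nat -> M * M, exists m n, (m < n)%N /\
     exists2 f, Aut f & f (p m).1 = (p n).1 /\ f (p m).2 = (p n).2)
  (Def_thick : forall x, Def (Cn x))
  (Def_cone : forall x a, x < l a -> Def (bc x (l a)))
  (Def_cones : forall x i, Def [set h | x < l h /\ bc x (l h) `<=` P i])
  (Def_diff : forall X Y, Def X -> Def Y -> Def (X `\` Y)).

Definition acts (f : M -> M) (t : S -> S) : Prop :=
  [/\ Aut f, bijective t & forall x g, (t x <= l (f g)) = (x <= l g)].

Lemma aut_acts f : Aut f -> exists t, acts f t.
Proof. by move=> Af; have [t [tb tf]] := Aut_tree Af; exists t. Qed.

Let sep := star_sep g0 Tgood lf_leaves.
Let leaf_max := star_leaf_max lf_leaves.

Lemma leaf_le_leaf g h : l g <= l h -> g = h.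
Proof. by move=> /leaf_max /of_tree_inj /lf_inj. Qed.

Lemma sep_witness x y : x < y -> exists2 g, x <= l g & ~ y <= l g.
Proof.
move=> xy; apply: contrapT => ng; have : y <= x.
  by apply: sep => g xg; apply: contrapT => nyg; apply: ng; exists g.
by rewrite (lt_geF xy).
Qed.

Section Action.
Variables (f : M -> M) (t : S -> S).
Hypothesis ft : acts f t.

Let Af : Aut f. Proof. by case: ft. Qed.
Let tf x g : (t x <= l (f g)) = (x <= l g). Proof. by case: ft. Qed.
Let t_surj y : exists x, t x = y.
Proof. by have [_ [t' _ tK] _] := ft; exists (t' y). Qed.

Lemma acts_le x y : (t x <= t y) = (x <= y).
Proof.
apply/idP/idP => xy; apply: sep => g yg.
  by rewrite -tf; apply: le_trans xy _; rewrite tf.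
have [h hg] := Aut_surj Af g; move: yg; rewrite -hg !tf; exact: le_trans.
Qed.

Lemma acts_inj : injective t.
Proof. by have [_ [t' tK _] _] := ft; exact: can_inj tK. Qed.

Lemma acts_lt x y : (t x < t y) = (x < y).
Proof. by rewrite !lt_def acts_le (inj_eq acts_inj). Qed.

Lemma acts_leaf g : t (l g) = l (f g).
Proof.
apply: leaf_max.
apply: sep => h; have [h' <-] := Aut_surj Af h.
by rewrite tf => /leaf_le_leaf ->.
Qed.

Lemma acts_thick x : f @` Cn x = Cn (t x).
Proof.
apply/seteqP; split=> [_ [g xg <-]|h]; first by rewrite /thick_cone /= tf.
have [g <-] := Aut_surj Af h; rewrite /thick_cone /= tf => xg.
by exists g.
Qed.

Lemma acts_branch_cone x y g : bc (t x) (t y) (f g) <-> bc x y g.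
Proof.
split=> [[z [xz zy zg]]|[z [xz zy zg]]].
  have [w E] := t_surj z; exists w.
  by rewrite -E acts_lt in xz; rewrite -E acts_le in zy; rewrite -E tf in zg.
by exists (t z); rewrite acts_lt acts_le tf.
Qed.

Lemma acts_image (X Y : set M) : (forall g, Y (f g) <-> X g) -> f @` X = Y.
Proof.
move=> XY; apply/seteqP; split=> [_ [g Xg <-]|h]; first exact/XY.
by have [g <-] := Aut_surj Af h => /XY Xg; exists g.
Qed.

Lemma acts_multicolored x : multicolored (t x) <-> multicolored x.
Proof.
split=> m [i iP]; apply: m; exists i => g.
  by have [h <-] := Aut_surj Af g; rewrite /thick_cone /= tf => /iP /(Aut_P i h Af).
by move=> xg; apply/(Aut_P i g Af)/iP; rewrite /thick_cone /= tf.
Qed.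

Lemma acts_sided i x : sided i (t x) <-> sided i x.
Proof.
split=> [[y [my xy yP]]|[y [my xy yP]]].
  have [z E] := t_surj y; exists z; rewrite -E in my xy yP; split.
  - exact/acts_multicolored.
  - by rewrite -acts_lt.
  - move=> g [xg nbg]; apply/(Aut_P i g Af)/yP; split.
      by rewrite /thick_cone /= tf.
    by move/acts_branch_cone.
exists (t y); split; [exact/acts_multicolored|by rewrite acts_lt|].
move=> h; have [g <-] := Aut_surj Af h; rewrite /thick_cone => -[/= xg nbg].
apply/(Aut_P i g Af)/yP; split; first by rewrite /thick_cone /= -tf.
by move/acts_branch_cone.
Qed.

Lemma acts_convex i x y : convex i (t x) (t y) <-> convex i x y.
Proof.
rewrite /convex !acts_le; split=> -[xy H]; split=> // v.
  by move=> vP; apply/acts_sided/H; rewrite !acts_le.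
have [w <-] := t_surj v; rewrite !acts_le => vP.
exact/acts_sided/H.
Qed.

Lemma acts_bot o : (forall x, o <= x) -> t o = o.
Proof.
move=> oP; apply/le_anti; rewrite oP andbT.
by have [o' E] := t_surj o; rewrite -{2}E acts_le.
Qed.
End Action.

Definition top g x : Prop :=
  [/\ multicolored x, x <= l g & forall z, multicolored z -> z <= l g -> z <= x].

Lemma top_uniq g x y : top g x -> top g y -> x = y.
Proof.
by move=> [mx xg xP] [my yg yP]; apply/le_anti; rewrite xP // yP.
Qed.

Lemma acts_top f t g x : acts f t -> top g x -> top (f g) (t x).
Proof.
move=> ft [mx xg xP]; have [_ [t' _ t'K] tf] := ft; split.
- exact/(acts_multicolored ft).
- by rewrite tf.
- move=> z; rewrite -(t'K z) => /(acts_multicolored ft) mz.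
  by rewrite tf (acts_le ft); exact: xP.
Qed.

(** This excludes -oo only. At a proper sided point the side is nonempty, so leaves of M_i can be
    used to move the point. *)
Definition proper x : Prop :=
  forall y, x < y -> exists2 g, x <= l g & ~ bc x y g.

Lemma gt_bot_proper o x : (forall y, o <= y) -> x <> o -> proper x.
Proof.
move=> oP xo; have [//|[_ xP]] := star_node Tgood lf_leaves x.
by case: xo; apply/le_anti; rewrite oP xP.
Qed.

Lemma sided_top i x y g : sided i x -> multicolored y -> x < y ->
  x <= l g -> ~ bc x y g -> P i g /\ top g x.
Proof.
move=> sx my xy xg nbg; split; first exact: sided_cone sx my xy _ _.
split=> //; first exact: sided_multicolored sx.
move=> z mz zg; have [//|xz] := chain zg xg.
have [->//|nzx] := eqVneq z x.
have xz' : x < z by rewrite lt_neqAle eq_sym nzx.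
have [w [xw wy wz]] := sided_meet sx my mz xy xz'.
by case: nbg; exists w; split=> //; exact: le_trans zg.
Qed.

Lemma proper_top i x : sided i x -> proper x -> exists2 g, P i g & top g x.
Proof.
move=> sx px; have [y [my xy _]] := sx; have [g xg nbg] := px y xy.
by have [] := sided_top sx my xy xg nbg; exists g.
Qed.

(** Each of the two points is the last point of Theta1 on the branch of a leaf of [P i], and
    automorphisms are transitive on these leaves. *)
Lemma proper_conj i x y : sided i x -> sided i y -> proper x -> proper y ->
  exists f t, acts f t /\ t x = y.
Proof.
move=> sx sy /(proper_top sx) [g Pg gx] /(proper_top sy) [h Ph hy].
have [f Af fg] := Aut_trans Pg Ph; have [t ft] := aut_acts Af.
exists f, t; split=> //; apply: top_uniq hy.
by rewrite -fg; exact: acts_top.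
Qed.

(** There are finitely many keys; [rep] chooses one conjugate for each of them. *)
Lemma finite_conj (X : set M) x :
  (forall f1 t1 f2 t2, acts f1 t1 -> acts f2 t2 -> key (t1 x) = key (t2 x) ->
     f1 @` X = f2 @` X) ->
  finite_set [set f @` X | f in Aut].
Proof.
move=> H; pose rep k := if pselect (exists f t, acts f t /\ key (t x) = k) is left E
  then projT1 (cid E) @` X else set0.
apply: (@sub_finite_set _ _ (range rep)); last first.
  by apply: finite_image; exact: finite_finset.
move=> _ [f Af <-]; have [t ft] := aut_acts Af; exists (key (t x)) => //.
rewrite /rep; case: pselect => [E|[]]; last by exists f, t.
by case: cid => f' /= [t' [ft' kt]]; exact: H ft' ft kt.
Qed.

Lemma key_sandwich x y z : x <= y -> y <= z -> key x = key z -> key y = key z.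
Proof.
move=> xy yz kxz; by apply/eqP; rewrite finset.eqEsubset -{1}kxz !key_sub.
Qed.

Lemma key_base x y c : key x = key y -> c \in all_bases -> x <= c -> y <= c.
Proof. by move=> /key_eqP kxy cD; rewrite kxy. Qed.

(** Both points are below a common base, and what is below a point is a chain. *)
Lemma key_comparable x y : multicolored x -> key x = key y -> x <= y \/ y <= x.
Proof.
move=> /multicolored_base [c cD xc] kxy.
exact: chain xc (key_base kxy cD xc).
Qed.

Lemma key_below_sided i x y g v : x < y -> key x = key y -> multicolored y ->
  x <= l g -> ~ y <= l g -> P i g -> x <= v -> v < y -> sided i v.
Proof.
move=> xy kxy my xg nyg Pg xv vy; have [h vh nyh] := sep_witness vy.
apply: key_sided vy (key_sandwich xv (ltW vy) kxy) (my) (vh) (nyh) _.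
exact: gap xy kxy xg nyg (le_trans xv vh) nyh Pg.
Qed.

(** A leaf of colour [i] branches off at the proper point [x]; by [gap] all leaves branching off
    before [y] have the same colour. *)
Lemma key_convex i x y : sided i x -> sided i y -> proper x -> key x = key y ->
  x <= y -> convex i x y.
Proof.
move=> sx sy px kxy xy; have [<-|nxy] := eqVneq x y; first exact: convex_refl.
have xy' : x < y by rewrite lt_neqAle nxy.
have my := sided_multicolored sy.
have [g xg nbg] := px y xy'; have [Pg _] := sided_top sx my xy' xg nbg.
have nyg : ~ y <= l g by move=> yg; apply: nbg; exact: thick_branch_cone.
split=> [|v []]; first by left.
  move=> /andP[xv]; rewrite le_eqVlt => /predU1P[->//|].
  exact: key_below_sided kxy my xg nyg Pg xv.
by move=> /andP[yv vx]; have := le_trans yv vx; rewrite (lt_geF xy').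
Qed.

(** * Cuts of a branch without a last point *)

Definition limit_point u := [/\ ~ multicolored u, forall z, z < u -> multicolored z
    & forall z, z < u -> exists2 z', z < z' & z' < u].

Lemma top_or_limit g : (exists x, top g x) \/
  exists2 u, u <= l g & limit_point u.
Proof.
have [o oP] := @star_bot d T.
have [E|ntop] := pselect (exists x, top g x); [by left|right].
have [mo|nmo] := pselect (multicolored o); last first.
  by exists o => //; split=> // z /lt_geF; rewrite oP.
pose Z := [set z | multicolored z /\ z <= l g].
have [|z0 [mz0 z0g] z0P] := key_up all_bases (Z := Z); first by exists o; split.
have [c cD z0c] := multicolored_base mz0.
pose s := [seq c <- all_bases | z0 <= c].
(* The supremum of [Z] has to be produced: the bases above [z0] are above all of [Z], and their
   meet, cut down to the branch of [g], is the candidate. *)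
have [m mP] : exists m, forall w, w <= m <-> forall c, c \in s -> w <= c.
  by apply: (@glb_seq d T c); rewrite mem_filter z0c.
have [u uP] := meet m (l g).
have Zu z : Z z -> z <= u.
  move=> [mz zg]; rewrite uP zg andbT; apply/mP => c'; rewrite mem_filter => /andP[z0c' c'D].
  have [zz0|z0z] := chain zg z0g; first exact: le_trans z0c'.
  by apply: key_base z0c' => //; apply/esym/z0P.
have /andP[um ug] : (u <= m) && (u <= l g) by rewrite -uP.
have z0u : z0 <= u by apply: Zu.
have kz0u : key z0 = key u.
  apply/key_eqP => c' c'D; apply/idP/idP => [z0c'|]; last exact: le_trans.
  by apply: le_trans um _; apply: (mP m).1 => //; rewrite mem_filter z0c'.
have nmu : ~ multicolored u.
  by move=> mu; apply: ntop; exists u; split=> // z mz zg; exact: Zu.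
have {}z0u : z0 < u.
  by rewrite lt_neqAle z0u andbT; apply/eqP => E; apply: nmu; rewrite -E.
have lu z : z < u -> multicolored z.
  move=> zu; have zg : z <= l g by exact: le_trans (ltW zu) ug.
  have [[z' [mz' z'g] zz']|nz'] := pselect (exists2 z', Z z' & z <= z').
    exact: multicolored_down mz'.
  have z0z : z0 <= z.
    have [//|zz0] := chain z0g zg.
    by case: nz'; exists z0.
  (* All leaves above [u] have one colour, but [z0] is multicolored; so the leaves between [z0] and
     [u] have a second colour, and [z] is below leaves of both. *)
  have [j uj] := contrapT nmu; have [k uk] := leaf_above u.
  have /existsNP [h /not_implyP [z0h nPh]] : ~ Cn z0 `<=` P j.
    by move=> H; apply: mz0; exists j.
  have nuh : ~ u <= l h by move=> /uj.
  have [i Pih] := P_cover h; have [h' zh' nuh'] := sep_witness zu.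
  have Pih' := gap z0u kz0u z0h nuh (le_trans z0z zh') nuh' Pih.
  apply: two_multicolored Pih' (uj k uk) zh' (le_trans (ltW zu) uk).
  by move=> ij; apply: nPh; rewrite -ij.
exists u => //; split=> // z zu.
have mz := lu z zu; have zg : z <= l g by exact: le_trans (ltW zu) ug.
have /existsNP [z' /not_implyP [mz' /not_implyP [z'g nz'z]]] :
    ~ forall z', multicolored z' -> z' <= l g -> z' <= z.
  by move=> H; apply: ntop; exists z.
exists z'.
  have [zz'|//] := chain zg z'g; rewrite lt_neqAle zz' andbT.
  by apply/eqP => E; apply: nz'z; rewrite E.
have := Zu z' (conj mz' z'g); rewrite le_eqVlt => /predU1P[E|//].
by case: nmu; rewrite -E.
Qed.

Lemma acts_limit f t u : acts f t -> limit_point u -> limit_point (t u).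
Proof.
move=> ft [nmu lu uP]; have [_ [t' _ t'K] _] := ft; split.
- by move/(acts_multicolored ft).
- move=> z; rewrite -(t'K z) (acts_lt ft) => /lu mz.
  exact/(acts_multicolored ft).
- move=> z; rewrite -(t'K z) (acts_lt ft) => /uP [z' zz' z'u].
  by exists (t z'); rewrite (acts_lt ft).
Qed.

(** Keys are eventually constant below [u], so a base above a late point is above all points below
    [u]. Its meet with [u] is [u], since otherwise a point strictly between them contradicts
    this. *)
Lemma limit_point_base u : limit_point u ->
  (exists2 c, c \in all_bases & u <= c) \/ forall x, u <= x.
Proof.
move=> [nmu lu uP]; have [o oP] := @star_bot d T.
have [->|nou] := eqVneq u o; [by right|left].
have ou : o < u by rewrite lt_neqAle eq_sym nou oP.
have [|z0 z0u z0P] := key_up all_bases (Z := [set z | z < u]); first by exists o.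
have [c cD z0c] := multicolored_base (lu z0 z0u); exists c => //.
have uc z : z < u -> z <= c.
  move=> zu; have [zz0|z0z] := chain (ltW zu) (ltW z0u); first exact: le_trans z0c.
  by apply: key_base z0c => //; apply/esym/z0P.
have [m mP] := meet c u; have /andP[mc mu] : (m <= c) && (m <= u) by rewrite -mP.
have [<-//|nmu'] := eqVneq m u.
have /uP [z mz zu] : m < u by rewrite lt_neqAle nmu'.
have : z <= m by rewrite mP uc // ltW.
by rewrite (lt_geF mz).
Qed.

Lemma limit_point_key u v : limit_point u -> limit_point v -> key u = key v -> u = v.
Proof.
move=> lu lv kuv.
have uv : u <= v \/ v <= u.
  have [[c cD uc]|uP] := limit_point_base lu; last by left.
  exact: chain uc (key_base kuv cD uc).
have [nmu uP _] := lu; have [nmv vP _] := lv.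
by case: uv; rewrite le_eqVlt => /predU1P[->//|]; [move/vP|move/uP].
Qed.

(** A nonempty subset of [P i] has orbit [P i] by transitivity, and definability with finitely many
    conjugates amounts to definability over acl(0). *)
Definition solves i (X : set M) : Prop :=
  [/\ X !=set0, X `<=` P i, Def X, finite_set [set f @` X | f in Aut] &
    [\/ exists2 x, Theta lf P e x & cones lf x X,
        exists2 x, Theta lf P e x & almost_thick_cone lf x X
      | exists b (a : T),
          [/\ Theta lf P e b, Theta lf P e (of_tree a), (b < of_tree a)%O,
              dense_without_extremities (open_itv b (of_tree a))
            & X = pruned_cone lf b a]]].

Lemma limit_case i g u : P i g -> u <= l g -> limit_point u -> solves i (Cn u).
Proof.
move=> Pg ug lu; have [nmu uP ub] := lu; split.
- by exists g.
- by have [j uj] := contrapT nmu; rewrite (P_disj Pg (uj g ug)); exact: uj.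
- exact: Def_thick.
- apply: (finite_conj (x := u)) => f1 t1 f2 t2 ft1 ft2 k12.
  rewrite (acts_thick ft1) (acts_thick ft2); congr thick_cone.
  by apply: limit_point_key k12; [exact: (acts_limit ft1)|exact: (acts_limit ft2)].
- apply: Or32; exists u; first by left; left; left; exact: ThetaU_sup.
  have [ul|nul] := pselect (exists a, u = l a); [by right|left].
  exists (cones lf u); first by rewrite setDv; split=> //; exact: finite_set0.
  have gtu h : u <= l h -> u < l h.
    by move=> uh; rewrite lt_neqAle uh andbT; apply/eqP => E; apply: nul; exists h.
  apply/seteqP; split=> [h uh|h [_ [a ua <-]]].
    exists (cone_of lf u h); first by exists h => //; exact: gtu.
    by rewrite cone_ofE; exists (l h); rewrite (gtu _ uh).
  rewrite cone_ofE => -[z [uz _ zh]]; exact: le_trans (ltW uz) zh.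
Qed.

Lemma top_lt g x : top g x -> x < l g.
Proof.
move=> [mx xg _]; rewrite lt_neqAle xg andbT; apply/eqP => E; apply: mx.
have [i Pg] := P_cover g; exists i => h; rewrite /thick_cone /= E.
by move=> /leaf_le_leaf <-.
Qed.

(** Beyond its last multicolored point, the branch of [g] carries only thick cones of one colour,
    that of [g]. *)
Lemma top_cone i g x : top g x -> P i g -> bc x (l g) `<=` P i.
Proof.
move=> [mx xg xP] Pg h [z [xz zg zh]].
have nmz : ~ multicolored z by move=> /xP /(_ zg); rewrite (lt_geF xz).
by have [j zj] := contrapT nmz; rewrite (P_disj Pg (zj g zg)); exact: zj.
Qed.

(** * One-coloured cones at a last point of Theta1 *)

Definition monochromatic_cones i x : set (set M) :=
  [set K | cones lf x K /\ K `<=` P i].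

Lemma acts_monochromatic_cones i f t x K : acts f t ->
  monochromatic_cones i x K -> monochromatic_cones i (t x) (f @` K).
Proof.
move=> ft [[g xg <-] KP]; have [Af _ tf] := ft; split.
  exists (f g); first by rewrite /= -(acts_leaf ft) (acts_lt ft).
  rewrite !cone_ofE -(acts_leaf ft); apply/esym/(acts_image ft) => h.
  exact: acts_branch_cone.
by move=> _ [h /KP Ph <-]; apply/(Aut_P i h Af).
Qed.

Lemma acts_monochromatic_cones_inv i f t x K : acts f t ->
  monochromatic_cones i (t x) K ->
  exists2 K', monochromatic_cones i x K' & K = f @` K'.
Proof.
move=> ft [[g xg KE] KP]; have [Af _ tf] := ft.
have [h hg] := Aut_surj Af g; rewrite -hg in xg KE.
have E : K = f @` bc x (l h).
  rewrite -KE cone_ofE -(acts_leaf ft); apply/esym/(acts_image ft) => h'.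
  exact: acts_branch_cone.
exists (bc x (l h)); last exact: E.
split; first by exists h; rewrite ?cone_ofE //= -(acts_lt ft) (acts_leaf ft).
by move=> h' bh; apply/(Aut_P i h' Af)/KP; rewrite E; exists h'.
Qed.

(** The key fixes the image of [x], and a conjugate of [K] is one of the finitely many one-coloured
    cones there. *)
Lemma finite_monochromatic_conj i x K : finite_set (monochromatic_cones i x) ->
  monochromatic_cones i x K ->
  (forall f1 t1 f2 t2, acts f1 t1 -> acts f2 t2 -> key (t1 x) = key (t2 x) ->
     t1 x = t2 x) ->
  finite_set [set f @` K | f in Aut].
Proof.
move=> fin mK H.
pose rep k := if pselect (exists f t, acts f t /\ key (t x) = k) is left E
  then (fun K => projT1 (cid E) @` K) @` monochromatic_cones i x else set0.
apply: (@sub_finite_set _ _ (\bigcup_k rep k)); last first.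
  apply: bigcup_finite => [|k _]; first exact: finite_finset.
  rewrite /rep; case: pselect => [E|_]; last exact: finite_set0.
  exact: finite_image.
move=> _ [f Af <-]; have [t ft] := aut_acts Af; exists (key (t x)) => //.
rewrite /rep; case: pselect => [E|[]]; last by exists f, t.
case: cid => f' /= [t' [ft' kt]].
have := acts_monochromatic_cones ft mK; rewrite (H _ _ _ _ ft ft') //.
by move=> /(acts_monochromatic_cones_inv ft') [K' mK' ->]; exists K'.
Qed.

(** A cone at [x] without special points contains no cone point of an [e i] and no base, so
    [comb_set_cone] applies to it. *)
Definition special_points : set M :=
  \bigcup_i cone_points (e i) `|`
  [set g | exists2 c, c \in all_bases & g = projT1 (cid (leaf_above c))].

Lemma finite_special_points : finite_set special_points.
Proof.
rewrite finite_setU; split.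
  by apply: bigcup_finite => [|i _]; [exact: finite_finset|exact: finite_cone_points].
apply: (@sub_finite_set _ _ ((fun c => projT1 (cid (leaf_above c))) @` [set` all_bases])).
  by move=> g [c cD ->]; exists c.
by apply: finite_image; exact: finite_seq.
Qed.

(** All cones at [x] without special points look the same to every [e i]. Among infinitely many
    cones of colour [i] there is such a cone, so all of these have colour [i], and only finitely
    many cones remain. *)
Lemma cofinite_monochromatic i x : ~ finite_set (monochromatic_cones i x) ->
  finite_set (cones lf x `\` monochromatic_cones i x).
Proof.
move=> inf.
pose Bd := (fun a => bc x (l a)) @` special_points.
have fBd : finite_set Bd by apply: finite_image; exact: finite_special_points.
have bcE a g : x < l a -> bc x (l a) g -> bc x (l a) = bc x (l g).
  by move=> xa; exact: branch_cone_eq.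
have avoid a h b : x < l a -> ~ Bd (bc x (l a)) -> bc x (l a) h ->
    special_points b -> ~ bc x (l b) h.
  move=> xa nBd ah sb bh; apply: nBd; exists b => //.
  have xb : x < l b by have [z [xz zb _]] := bh; exact: lt_le_trans zb.
  by rewrite (bcE _ _ xb bh) (bcE _ _ xa ah).
have xlt a h : bc x (l a) h -> x < l h by move=> [z [xz _ zh]]; exact: lt_le_trans zh.
have same a1 h1 a2 h2 : x < l a1 -> ~ Bd (bc x (l a1)) -> bc x (l a1) h1 ->
    x < l a2 -> ~ Bd (bc x (l a2)) -> bc x (l a2) h2 -> P i h1 -> P i h2.
  move=> x1 n1 b1 x2 n2 b2; rewrite -!P_comb.
  apply: (comb_set_cone Tgood (xlt _ _ b1) (xlt _ _ b2)) => [a ea|c ec xc].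
    by split; [apply: avoid n1 b1 _|apply: avoid n2 b2 _] => //; left; exists i.
  have cD : c \in all_bases by apply/all_basesP; exists i.
  pose b := projT1 (cid (leaf_above c)).
  have cb : c <= l b by rewrite /b; case: cid.
  have -> : bc x c = bc x (l b) by rewrite (branch_cone_le lf Tgood xc cb).
  by split; [apply: avoid n1 b1 _|apply: avoid n2 b2 _] => //; right; exists c.
have [K0 [[[a0 xa0 K0E] K0P] nBd0]] : exists K, monochromatic_cones i x K /\ ~ Bd K.
  apply: contrapT => nK; apply: inf; apply: sub_finite_set fBd => K mK.
  by apply: contrapT => nBd; apply: nK; exists K.
rewrite cone_ofE in K0E.
apply: sub_finite_set fBd => K [[a xa KE] nm]; apply: contrapT => nBd; apply: nm.
split; first by exists a.
rewrite cone_ofE in KE; rewrite -KE in nBd *.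
move=> h bh; rewrite -K0E in nBd0 K0P.
have b0 : bc x (l a0) a0 by exists (l a0).
exact: same xa0 nBd0 b0 xa nBd bh (K0P _ b0).
Qed.

Lemma cone_case i g x : top g x -> P i g -> Theta lf P e x ->
  (forall f1 t1 f2 t2, acts f1 t1 -> acts f2 t2 -> key (t1 x) = key (t2 x) ->
     t1 x = t2 x) ->
  exists X, solves i X.
Proof.
move=> gx Pg Tx H; have xg := top_lt gx; have cP := top_cone gx Pg.
have gg : bc x (l g) g by exists (l g).
have mK : monochromatic_cones i x (bc x (l g)).
  by split=> //; exists g; rewrite ?cone_ofE.
have [fin|inf] := pselect (finite_set (monochromatic_cones i x)).
  exists (bc x (l g)); split=> //.
  - by exists g.
  - exact: Def_cone.
  - exact: finite_monochromatic_conj fin mK H.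
  - by apply: Or31; exists x => //; case: mK.
pose X := [set h | x < l h /\ bc x (l h) `<=` P i].
exists X; split.
- by exists g.
- by move=> h [xh]; apply; exists (l h).
- exact: Def_cones.
- apply: (finite_conj (x := x)) => f1 t1 f2 t2 ft1 ft2 /(H _ _ _ _ ft1 ft2) E.
  have img f t : acts f t -> f @` X = [set h | t x < l h /\ bc (t x) (l h) `<=` P i].
    move=> ft; have [Af _ _] := ft; apply: (acts_image ft) => h.
    rewrite /X /= -(acts_leaf ft) (acts_lt ft); split=> -[xh hP]; split=> // h'.
      by move=> bh; apply/(Aut_P i h' Af)/hP/(acts_branch_cone ft).
    have [h'' <-] := Aut_surj Af h' => /(acts_branch_cone ft) /hP.
    by move/(Aut_P i h'' Af).
  by rewrite (img _ _ ft1) (img _ _ ft2) E.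
- apply: Or32; exists x => //; left; exists (monochromatic_cones i x).
    by split; [move=> K []|exact: cofinite_monochromatic].
  apply/seteqP; split=> [h [xh hP]|h [K [[a xa <-] aP] ah]].
    exists (bc x (l h)); last by exists (l h).
    by split=> //; exists h; rewrite ?cone_ofE.
  rewrite cone_ofE in ah aP.
  split; first by have [z [xz _ zh]] := ah; exact: lt_le_trans zh.
  by rewrite -(branch_cone_eq Tgood xa ah).
Qed.

Lemma Theta_inf i x b : sided i x -> infimums (convex i x) b -> Theta lf P e b.
Proof.
move=> sx Jb; have bx : b <= x by apply: Jb.1; exact: convex_refl.
have mb : multicolored b := multicolored_down bx (sided_multicolored sx).
have [rb|nrb] := pselect (rest b); first by right; exact: ThetaI_inf Jb.
by left; apply: contrapT => nUBS; apply: nrb; split=> //; exact/Theta1E.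
Qed.

Lemma Theta_not_rest x : multicolored x -> ~ rest x -> Theta lf P e x.
Proof.
move=> mx nrx; left; apply: contrapT => nUBS; apply: nrx; split=> //; exact/Theta1E.
Qed.

(** * Intervals with more than one point *)

Section Pruned.
Variables (i : 'I_r) (x : S) (o : S).
Hypotheses (oP : forall y, o <= y) (sx : sided i x) (px : proper x)
  (x_not_alone : exists2 y, convex i x y & y <> x).

(* The maximal interval of [x] without -oo, whose side may be empty. *)
Let J z : Prop := convex i x z /\ z <> o.

Let J_sided z : J z -> sided i z. Proof. by move=> [/convex_r]. Qed.
Let J_multi z : J z -> multicolored z. Proof. by move=> /J_sided/sided_multicolored. Qed.
Let J_proper z : J z -> proper z. Proof. by move=> [_]; exact: gt_bot_proper. Qed.
Let J_convex y z : J y -> J z -> convex i y z.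
Proof. by move=> [/convex_sym xy _] [xz _]; exact: convex_trans xy xz. Qed.
Let J_total y z : J y -> J z -> y <= z \/ z <= y.
Proof. by move=> Jy Jz; have [] := J_convex Jy Jz. Qed.
Let J_between y z v : convex i x y -> convex i x z -> y <= v -> v <= z -> v <> o -> J v.
Proof.
move=> xy xz yv vz vo; split=> //; apply: convex_trans (xy) _.
by apply: convex_between (convex_trans (convex_sym xy) xz) _; left; rewrite yv.
Qed.

(** Automorphisms fix the least point, but [x] is conjugate to another point. *)
Let x_neq_o : x <> o.
Proof.
move=> xo; have [y xy yx] := x_not_alone.
have yo : y <> o by rewrite -xo.
have [f [t [ft tx]]] := proper_conj sx (convex_r xy) px (gt_bot_proper oP yo).
by apply: yo; rewrite -tx xo (acts_bot ft oP).
Qed.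

Let Jx : J x.
Proof. by split=> //; exact: convex_refl. Qed.

(** If the other point is the least one, it cannot be proper, as it is not conjugate to [x]; it is
    then -oo, and a further point lies strictly between it and [x]. *)
Let J_two : exists2 y, J y & y <> x.
Proof.
have [y xy yx] := x_not_alone.
have [yo|yo] := pselect (y = o); last by exists y.
have [py|[py _]] := star_node Tgood lf_leaves y.
  have [f [t [ft ty]]] := proper_conj (convex_r xy) sx py px.
  by case: x_neq_o; rewrite -ty yo (acts_bot ft oP).
have yx' : y < x by rewrite lt_neqAle yo oP andbT; apply/eqP => E; apply: x_neq_o.
have [[z /andP[yz zx]] _] := py x yx'; exists z; last by move=> E; rewrite E ltxx in zx.
apply: J_between xy (convex_refl sx) (ltW yz) (ltW zx) _.
by move=> E; move: yz; rewrite E yo ltxx.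
Qed.

Let J_conj y z : J y -> J z -> exists f t, [/\ acts f t, t y = z & forall w, J (t w) <-> J w].
Proof.
move=> Jy Jz; have [f [t [ft ty]]] := proper_conj (J_sided Jy) (J_sided Jz)
  (J_proper Jy) (J_proper Jz).
exists f, t; split=> // w.
have E : convex i x (t w) <-> convex i x w.
  split=> xw.
    apply: convex_trans Jy.1 _; apply/(acts_convex ft); rewrite ty.
    exact: convex_trans (convex_sym Jz.1) xw.
  apply: convex_trans Jz.1 _; rewrite -ty; apply/(acts_convex ft).
  exact: convex_trans (convex_sym Jy.1) xw.
rewrite /J E; split=> -[xw two]; split=> // wo; apply: two.
  by rewrite wo (acts_bot ft oP).
by apply: (acts_inj ft); rewrite (acts_bot ft oP).
Qed.

Let J_lt : exists y z, [/\ J y, J z & y < z].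
Proof.
have [y Jy yx] := J_two; have [xy|yx'] := J_total Jx Jy.
  by exists x, y; split=> //; rewrite lt_neqAle xy andbT; apply/eqP => E; apply: yx.
by exists y, x; split=> //; rewrite lt_neqAle yx' andbT; apply/eqP.
Qed.

Let J_nomin z : J z -> exists2 w, J w & w < z.
Proof.
move=> Jz; have [u [v [Ju Jv uv]]] := J_lt.
have [f [t [ft tv tJ]]] := J_conj Jv Jz.
by exists (t u); [exact/tJ|rewrite -tv (acts_lt ft)].
Qed.

Let J_nomax z : J z -> exists2 w, J w & z < w.
Proof.
move=> Jz; have [u [v [Ju Jv uv]]] := J_lt.
have [f [t [ft tu tJ]]] := J_conj Ju Jz.
by exists (t v); [exact/tJ|rewrite -tu (acts_lt ft)].
Qed.

(* In a discrete transitive chain the pairs (point, n-th successor) have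
   pairwise distinct types. *)
Let J_dense u v : J u -> J v -> u < v -> exists2 w, J w & u < w < v.
Proof.
move=> Ju Jv uv; apply: contrapT => nw.
pose succ w w' := [/\ J w', w < w' & forall z, J z -> ~ w < z < w'].
have ex_succ w : exists w', J w -> succ w w'.
  have [Jw|nJ] := pselect (J w); last by exists w.
  have [f [t [ft tu tJ]]] := J_conj Ju Jw; exists (t v) => _; split.
  - exact/tJ.
  - by rewrite -tu (acts_lt ft).
  - have [_ [t' _ tK] _] := ft.
    move=> z Jz; rewrite -tu -(tK z) !(acts_lt ft) => uzv.
    by apply: nw; exists (t' z) => //; apply/tJ; rewrite tK.
have succ_uniq w w1 w2 : succ w w1 -> succ w w2 -> w1 = w2.
  have half y z : succ w y -> succ w z -> y <= z -> y = z.
    move=> [Jy wy _] [_ _ zP]; rewrite le_eqVlt => /predU1P[//|yz].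
    by case: (zP y Jy); rewrite wy.
  move=> s1 s2; have [J1 _ _] := s1; have [J2 _ _] := s2.
  by have [le12|le21] := J_total J1 J2; [|symmetry]; exact: half.
have [next nextP] := choice ex_succ.
pose w n := iter n next u.
have Jw n : J (w n) by elim: n => //= n IH; have [] := nextP _ IH.
have w_succ n : succ (w n) (w n.+1) by exact: nextP (Jw n).
have w_lt m n : (m < n)%N -> w m < w n.
  elim: n => // n IH; rewrite ltnS leq_eqVlt => /predU1P[->|/IH mn].
    by have [] := w_succ n.
  by have [_ nn _] := w_succ n; exact: lt_trans nn.
(* Points are represented by leaves of which they are the last multicolored point, since [Aut_pairs]
   is about leaves. *)
have ex_top z : exists g, J z -> top g z.
  have [Jz|nJ] := pselect (J z); last by exists g0.
  by have [g _ gz] := proper_top (J_sided Jz) (J_proper Jz); exists g.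
have [h hP] := choice ex_top.
have [m [n [mn [f Af [/= fu fw]]]]] := Aut_pairs (fun n => (h u, h (w n))).
have [t ft] := aut_acts Af.
have tu : t u = u.
  by apply: top_uniq (hP u Ju); rewrite -fu; apply: acts_top => //; exact: hP.
have tw : t (w m) = w n.
  by apply: top_uniq (hP _ (Jw n)); rewrite -fw; apply: acts_top => //; exact: hP.
have tJ z : J (t z) <-> J z.
  have E : convex i u (t z) <-> convex i u z by rewrite -{1}tu; exact: acts_convex ft _ _ _.
  have uE y : convex i x y <-> convex i u y.
    by split=> c; [exact: convex_trans (convex_sym Ju.1) c|exact: convex_trans Ju.1 c].
  rewrite /J !uE E; split=> -[uz tzo]; split=> // zo; apply: tzo.
    by rewrite zo (acts_bot ft oP).
  by apply: (acts_inj ft); rewrite (acts_bot ft oP).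
have tw_id k : t (w k) = w k.
  elim: k => // k IH; apply: succ_uniq (w_succ k).
  have [Jk kk kP] := w_succ k; have [_ [t' _ tK] _] := ft; split.
  - exact/tJ.
  - by rewrite -{1}IH (acts_lt ft).
  - move=> z Jz; rewrite -{1}IH -(tK z) !(acts_lt ft); apply: kP.
    by apply/tJ; rewrite tK.
by have := w_lt _ _ mn; rewrite -tw tw_id ltxx.
Qed.

(** A lower bound with the key of the low points of [J] would belong to the interval, which has no
    least point. Hence some base [c] is above the lower bounds but not above [z0], and the meet of
    [c] and [z0] is the infimum. *)
Let J_inf : exists b, infimums (convex i x) b.
Proof.
have [co|nco] := pselect (convex i x o).
  by exists o; split=> [z _|w]; [exact: oP|apply].
have JE z : convex i x z -> J z by move=> xz; split=> // zo; apply: nco; rewrite -zo.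
have [|z0 Jz0 z0P] := key_down all_bases (Z := J); first by exists x.
have low_key v : (forall z, J z -> v <= z) -> key v <> key z0.
  move=> vlow kv; have vz0 : v < z0.
    have [w Jw wz0] := J_nomin Jz0; exact: le_lt_trans (vlow w Jw) wz0.
  have [w Jw wz0] := J_nomin Jz0; have mz0 := J_multi Jz0.
  have [h wh nbh] := J_proper Jw wz0.
  have [Ph _] := sided_top (J_sided Jw) mz0 wz0 wh nbh.
  have nzh : ~ z0 <= l h by move=> zh; apply: nbh; exact: thick_branch_cone.
  have vconv : convex i v z0.
    split=> [|v' []]; first by left; exact: ltW.
      move=> /andP[vv']; rewrite le_eqVlt => /predU1P[->|v'z]; first exact: J_sided.
      exact: key_below_sided vz0 kv mz0 (le_trans (vlow w Jw) wh) nzh Ph vv' v'z.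
    by move=> /andP[z0v' v'v]; have := le_trans z0v' v'v; rewrite (lt_geF vz0).
  have /JE Jv : convex i x v := convex_trans Jz0.1 (convex_sym vconv).
  by have [w' Jw' w'v] := J_nomin Jv; have := vlow w' Jw'; rewrite (lt_geF w'v).
have low_base v : (forall z, J z -> v <= z) ->
    exists c, [/\ c \in all_bases, v <= c & ~ z0 <= c].
  move=> vlow; apply: contrapT => nc; apply: (low_key v) => //.
  apply/key_eqP => c cD; apply/idP/idP => [vc|]; last exact: le_trans (vlow z0 Jz0).
  by apply: contrapT => nzc; apply: nc; exists c.
have [|b0 b0low b0P] := key_up all_bases (Z := [set v | forall z, J z -> v <= z]).
  by exists o => z _; exact: oP.
have [c [cD b0c nzc]] := low_base b0 b0low.
have [b bP] := meet c z0; have /andP[bc' bz0] : (b <= c) && (b <= z0) by rewrite -bP.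
have blow z : J z -> b <= z.
  move=> Jz; have [zz0|z0z] := J_total Jz Jz0; last exact: le_trans z0z.
  have [//|zb] := chain bz0 zz0; case: nzc.
  by apply: key_base cD (le_trans zb bc'); exact: z0P.
exists b; split=> [z /JE /blow //|v vlow].
have {}vlow z : J z -> v <= z by move=> [xz _]; exact: vlow.
have [//|bv] := chain (vlow z0 Jz0) bz0.
rewrite bP (vlow z0) // andbT; apply: key_base cD (b0c); apply/esym/b0P => //.
by apply: le_trans bv; rewrite bP b0c b0low.
Qed.

Let J_sup : exists a : S, [/\ Theta lf P e a, forall z, J z -> z <= a
  & forall w, (forall z, J z -> z <= w) -> a <= w].
Proof.
have [|z0 Jz0 z0P] := key_up all_bases (Z := J); first by exists x.
have mz0 := J_multi Jz0; have [c0 c0D z0c0] := multicolored_base mz0.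
pose s := [seq c <- all_bases | z0 <= c].
have [m mP] : exists m, forall w, w <= m <-> forall c, c \in s -> w <= c.
  by apply: (@glb_seq d T c0); rewrite mem_filter z0c0.
have m_ub z : J z -> z <= m.
  move=> Jz; apply/mP => c; rewrite mem_filter => /andP[z0c cD].
  have [zz0|z0z] := J_total Jz Jz0; first exact: le_trans z0c.
  by apply: key_base cD z0c; apply/esym/z0P.
have kz0m : key z0 = key m.
  apply/key_eqP => c cD; apply/idP/idP => [z0c|]; last exact: le_trans (m_ub _ Jz0).
  by apply: (mP m).1 => //; rewrite mem_filter z0c.
have [z1 Jz1 z01] := J_nomax Jz0.
have [h z0h nbh] := J_proper Jz0 z01.
have [Ph _] := sided_top (J_sided Jz0) (J_multi Jz1) z01 z0h nbh.
have nub_h v : (forall z, J z -> z <= v) -> ~ v <= l h.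
  move=> vub vh; apply: nbh; apply: (thick_branch_cone z01).
  exact: le_trans (vub _ Jz1) vh.
have ub_gt v : (forall z, J z -> z <= v) -> z0 < v.
  by move=> vub; exact: lt_le_trans z01 (vub _ Jz1).
have ub_notJ v : (forall z, J z -> z <= v) -> ~ J v.
  by move=> vub Jv; have [w /vub wv vw] := J_nomax Jv; rewrite (lt_geF vw) in wv.
have ub_key v : (forall z, J z -> z <= v) -> v <= m -> key z0 = key v.
  by move=> vub vm; rewrite (key_sandwich (ltW (ub_gt v vub)) vm kz0m) kz0m.
have below v v' : (forall z, J z -> z <= v) -> v <= m -> multicolored v ->
    z0 <= v' -> v' < v -> sided i v'.
  move=> vub vm mv; apply: (key_below_sided (ub_gt v vub) (ub_key v vub vm) mv z0h _ Ph).
  exact: nub_h.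
have inJ v : z0 <= v -> (forall v', z0 <= v' -> v' <= v -> sided i v') -> J v.
  move=> z0v vs; have [E|n0v] := eqVneq z0 v; first by rewrite -E.
  have z0v' : z0 < v by rewrite lt_neqAle n0v.
  split; last by move=> vo; have := oP z0; rewrite -vo (lt_geF z0v').
  apply: convex_trans Jz0.1 _; split=> [|v' []]; first by left.
    by move=> /andP[]; exact: vs.
  by move=> /andP[vv' v'z]; have := le_trans vv' v'z; rewrite (lt_geF z0v').
have least v w : (forall z, J z -> z <= v) -> v <= m -> multicolored v ->
    (forall z, J z -> z <= w) -> v <= w.
  move=> vub vm mv wub; have [u uP] := meet v w.
  have /andP[uv uw] : (u <= v) && (u <= w) by rewrite -uP.
  have uub z : J z -> z <= u by move=> Jz; rewrite uP vub // wub.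
  have [<-//|nuv] := eqVneq u v.
  have uv' : u < v by rewrite lt_neqAle nuv.
  case: (ub_notJ u uub); apply: inJ => [|v' z0v' v'u]; first exact: uub.
  exact: below vub vm mv z0v' (le_lt_trans v'u uv').
have [mleast|nleast] := pselect (forall w, (forall z, J z -> z <= w) -> m <= w).
  exists m; split=> //.
  have not_ub z : z < m -> exists2 w, J w & z < w.
    move=> zm; apply: contrapT => nw; suff : m <= z by rewrite (lt_geF zm).
    apply: mleast => w Jw; have [wz|zw] := chain (m_ub w Jw) (ltW zm) => //.
    move: zw; rewrite le_eqVlt => /predU1P[->//|zw].
    by case: nw; exists w.
  have [mm|nmm] := pselect (multicolored m); last first.
    left; left; left; apply: ThetaU_sup => // z /not_ub [w Jw zw].
      exact: multicolored_down (ltW zw) (J_multi Jw).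
    exists w => //; have [w' Jw' ww'] := J_nomax Jw.
    exact: lt_le_trans ww' (m_ub _ Jw').
  have [rm|nrm] := pselect (rest m); last exact: Theta_not_rest.
  (* Colour [i] would put [m] into [J], which has no last point. With another colour, [m] is the
     least point of its own interval, as the points just below it are in [J]; so [m] is in I. *)
  have [j sm] := rest_sided rm.
  have [ij|nij] := eqVneq j i.
    case: (ub_notJ m m_ub); apply: inJ => [|v z0v]; first exact: m_ub.
    rewrite le_eqVlt => /predU1P[->|vm]; first by rewrite -ij.
    exact: below m_ub (lexx m) mm z0v vm.
  apply: (Theta_inf sm); split=> [z mz|w]; last by apply; exact: convex_refl.
  have [le_mz zP] := mz; have [//|zm] : m <= z \/ z < m.
    have [->|nzm] := eqVneq z m; first by left.
    by case: le_mz => [|zm]; [left|right; rewrite lt_neqAle nzm].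
  have [w Jw zw] := not_ub z zm; have [w' Jw' ww'] := J_nomax Jw.
  have wm := lt_le_trans ww' (m_ub _ Jw').
  have sw : sided j w by apply: zP; right; rewrite !ltW.
  have [k wk nbk] := J_proper Jw wm; case/eqP: nij.
  have [Pjk _] := sided_top sw mm wm wk nbk.
  have [Pik _] := sided_top (J_sided Jw) mm wm wk nbk.
  exact: P_disj Pjk Pik.
(* Some upper bound is not above [m]. Its meet [v] with [m] is multicolored, and a multicolored
   point above [v] would make [v] sided and put it into [J]; so [v] ends a branch of Theta1 and is
   in U. *)
have /existsNP [w /not_implyP [wub nmw]] := nleast.
have [v vP] := meet w m; have /andP[vw vm] : (v <= w) && (v <= m) by rewrite -vP.
have vub z : J z -> z <= v by move=> Jz; rewrite vP wub // m_ub.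
have vm' : v < m by rewrite lt_neqAle vm andbT; apply/eqP => E; apply: nmw; rewrite -E.
have nmh := nub_h m m_ub.
have mv : multicolored v.
  have [k vk nmk] := sep_witness vm'.
  have Pk := gap (ub_gt m m_ub) kz0m z0h nmh (le_trans (vub _ Jz0) vk) nmk Ph.
  have /existsNP [k' /not_implyP [z0k' nPk']] : ~ Cn z0 `<=` P i.
    by move=> H; apply: mz0; exists i.
  have mk' : m <= l k'.
    by apply: contrapT => nmk'; apply: nPk'; exact: gap (ub_gt m m_ub) kz0m z0h nmh z0k' nmk' Ph.
  have [j Pjk'] := P_cover k'.
  apply: two_multicolored Pk (Pjk') vk (le_trans vm mk').
  by move=> ij; apply: nPk'; rewrite ij.
exists v; split=> //; last by move=> w'; exact: least.
left; left; left; apply: ThetaU_max => // y my vy; apply: contrapT => nyv.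
have {}vy : v < y by rewrite lt_neqAle vy andbT; apply/eqP => E; apply: nyv.
have [c cD yc] := multicolored_base my.
have mc : m <= c.
  apply: (mP m).1 => //; rewrite mem_filter cD andbT.
  exact: le_trans (vub _ Jz0) (le_trans (ltW vy) yc).
have sv : sided i v.
  exists y; split=> // k [vk nbk].
  have nmk : ~ m <= l k.
    move=> mk; apply: nbk; have [ym|my'] := chain yc mc.
      exact: thick_branch_cone vy (le_trans ym mk).
    by exists m.
  exact: gap (ub_gt m m_ub) kz0m z0h nmh (le_trans (vub _ Jz0) vk) nmk Ph.
case: (ub_notJ v vub); apply: inJ => [|v' z0v']; first exact: vub.
rewrite le_eqVlt => /predU1P[->//|v'v]; exact: below vub vm mv z0v' v'v.
Qed.

(** The pruned cone described through [J] instead of the extremities, so that its images under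
    automorphisms can be read off. *)
Let V := [set g | (exists2 z, J z & z <= l g) /\ exists2 z, J z & ~ z <= l g].

Let V_sub : V `<=` P i.
Proof.
move=> g [[z Jz zg] [z' Jz' nz'g]].
have [w wP] := meet z' (l g); have /andP[wz' wg] : (w <= z') && (w <= l g) by rewrite -wP.
have zz' : z <= z'.
  by have [//|z'z] := J_total Jz Jz'; case: nz'g; exact: le_trans zg.
have zw : z <= w by rewrite wP zz'.
have wz'' : w < z'.
  by rewrite lt_neqAle wz' andbT; apply/eqP => E; apply: nz'g; rewrite -E.
have sw : sided i w.
  have [_ zP] := J_convex Jz Jz'; apply: zP; left; by rewrite zw.
have [|//] := @sided_top i w z' g sw (J_multi Jz') wz'' wg.
move=> [v [wv vz' vg]]; have : v <= w by rewrite wP vz'.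
by rewrite (lt_geF wv).
Qed.

Let V_ne : V !=set0.
Proof.
have [q Jq xq] := J_nomax Jx; have [g xg nbg] := px xq.
exists g; split; [by exists x|exists q => // qg; apply: nbg; exact: thick_branch_cone].
Qed.

(** [V] depends only on the interval of [x], and images of [x] with the same key are in the same
    interval. *)
Let V_conj : finite_set [set f @` V | f in Aut].
Proof.
apply: (finite_conj (x := x)) => f1 t1 f2 t2 ft1 ft2 k12.
pose VJ y := [set g | (exists2 z, convex i y z /\ z <> o & z <= l g) /\
                      exists2 z, convex i y z /\ z <> o & ~ z <= l g].
have img f t : acts f t -> f @` V = VJ (t x).
  move=> ft; have [_ [t' t'K tK] tf] := ft; apply: (acts_image ft) => g.
  have E z : (convex i (t x) (t z) /\ t z <> o) <-> J z.
    rewrite /J (acts_convex ft); split=> -[xz zo]; split=> // E; apply: zo.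
      by rewrite E (acts_bot ft oP).
    by apply: (acts_inj ft); rewrite (acts_bot ft oP).
  split=> -[[z Jz zg] [z' Jz' z'g]]; split.
  - by exists (t' z); [apply/E; rewrite tK|rewrite -tf tK].
  - by exists (t' z'); [apply/E; rewrite tK|rewrite -tf tK].
  - by exists (t z); [exact/E|rewrite tf].
  - by exists (t z'); [exact/E|rewrite tf].
have neo f t : acts f t -> t x <> o.
  by move=> ft txo; apply: x_neq_o; apply: (acts_inj ft); rewrite (acts_bot ft oP).
have s1 : sided i (t1 x) by apply/(acts_sided ft1).
have s2 : sided i (t2 x) by apply/(acts_sided ft2).
have c12 : convex i (t1 x) (t2 x).
  have [le|le] := key_comparable (sided_multicolored s1) k12.
    by apply: key_convex => //; apply: gt_bot_proper (neo _ _ ft1).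
  by apply/convex_sym; apply: key_convex => //; apply: gt_bot_proper (neo _ _ ft2).
have VE y z : convex i y z -> VJ y `<=` VJ z.
  move=> yz g [[u [yu uo] ug] [v [yv vo] vg]].
  by split; [exists u|exists v] => //; split=> //; exact: convex_trans (convex_sym yz) _.
rewrite (img _ _ ft1) (img _ _ ft2); apply/seteqP; split; apply: VE => //.
exact: convex_sym.
Qed.

Lemma pruned_case : exists X, solves i X.
Proof.
have [b bJ] := J_inf; have [a [Ta aub aleast]] := J_sup.
have Tb := Theta_inf sx bJ.
have b_lt z : J z -> b < z.
  move=> Jz; have [w Jw wz] := J_nomin Jz.
  by apply: le_lt_trans wz; apply: bJ.1; case: Jw.
have a_gt z : J z -> z < a.
  by move=> Jz; have [w Jw zw] := J_nomax Jz; exact: lt_le_trans zw (aub w Jw).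
have ba : b < a by exact: lt_trans (b_lt x Jx) (a_gt x Jx).
have itvE z : (b < z < a) <-> J z.
  split=> [/andP[bz za]|Jz]; last by rewrite b_lt ?a_gt.
  have [w Jw zw] : exists2 w, J w & z <= w.
    apply: contrapT => nw; suff : a <= z by rewrite (lt_geF za).
    apply: aleast => w Jw; have [//|zw] := chain (ltW (a_gt w Jw)) (ltW za).
    by case: nw; exists w.
  have [w' xw' w'z] : exists2 w', convex i x w' & w' <= z.
    apply: contrapT => nw; suff : z <= b by rewrite (lt_geF bz).
    apply: bJ.2 => w' xw'; apply: contrapT => nzw'; apply: nw; exists w' => //.
    have [w'w|ww'] : w' <= w \/ w <= w'.
    - by have [] := convex_trans (convex_sym xw') Jw.1.
    - by have [//|zw'] := chain w'w zw.
    - by case: nzw'; exact: le_trans ww'.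
  apply: J_between xw' Jw.1 w'z zw _.
  by move=> zo; have := oP b; rewrite -zo (lt_geF bz).
have [a' aE] := gt_tree ba; have [al aal] := leaf_above a.
(* A cone minus a thick cone, which also makes it definable. *)
have VE : pruned_cone lf b a' = bc b (l al) `\` Cn a.
  rewrite (branch_cone_le lf Tgood ba aal); apply/seteqP; split=> g.
    move=> /andP[b1 b2]; split.
      exists (of_tree (lf g `&` a')%O); rewrite b1 of_tree_le leIl aE.
      by rewrite of_tree_le leIr.
    move=> ag; rewrite -aE in b2; have : a <= of_tree (lf g `&` a')%O.
      by move: ag; rewrite /thick_cone /= aE !of_tree_le lexI => ->; rewrite lexx.
    by rewrite (lt_geF b2).
  move=> [[z [bz za zg]] nag]; rewrite /pruned_cone /open_itv /=; apply/andP; split.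
    apply: lt_le_trans (bz) _; have [z' zE] := gt_tree bz.
    by move: za zg; rewrite zE aE !of_tree_le lexI => -> ->.
  rewrite lt_neqAle of_tree_le leIr andbT; apply/eqP => E; apply: nag.
  by rewrite /thick_cone /= aE -E of_tree_le leIl.
have VE' : V = bc b (l al) `\` Cn a.
  rewrite (branch_cone_le lf Tgood ba aal); apply/seteqP; split=> g.
    move=> [[z Jz zg] [z' Jz' nz'g]]; split.
      by exists z; rewrite b_lt // zg aub.
    by move=> ag; apply: nz'g; exact: le_trans (aub _ Jz') ag.
  move=> [[z [bz za zg]] nag]; split.
    exists z => //; apply/itvE; rewrite bz lt_neqAle za andbT.
    by apply/eqP => E; apply: nag; rewrite /thick_cone /= -E.
  apply: contrapT => nz; apply: nag; apply: aleast => z' Jz'.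
  by apply: contrapT => nz'; apply: nz; exists z'.
exists V; split=> //.
  by rewrite VE'; apply: Def_diff => //; apply: Def_cone; exact: lt_le_trans aal.
apply: Or33; exists b, a'; rewrite -aE; split=> //; last by rewrite VE VE'.
split.
- by exists x; apply/itvE.
- move=> u v /itvE Ju /itvE Jv uv; have [w Jw uwv] := J_dense Ju Jv uv.
  by exists w => //; apply/itvE.
- by move=> u /itvE /J_nomin [w Jw wu]; exists w => //; apply/itvE.
- by move=> u /itvE /J_nomax [w Jw wu]; exists w => //; apply/itvE.
Qed.
End Pruned.

Lemma classification i : P i !=set0 -> exists X, solves i X.
Proof.
move=> [g Pg]; have [o oP] := @star_bot d T.
have [[x gx]|[u ug lu]] := top_or_limit g; last first.
  by exists (Cn u); exact: limit_case ug lu.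
have [mx xg xP] := gx.
have [rx|nrx] := pselect (rest x); last first.
  apply: cone_case gx Pg (Theta_not_rest mx nrx) _ => f1 t1 f2 t2 ft1 ft2 k12.
  have m1 : multicolored (t1 x) by apply/(acts_multicolored ft1).
  have m2 : multicolored (t2 x) by apply/(acts_multicolored ft2).
  (* If the two images were distinct, the gap between them would make the lower one sided, hence in
     [rest], and [x] with it. *)
  have half f t f' t' : acts f t -> acts f' t' -> key (t x) = key (t' x) ->
      multicolored (t' x) -> t x <= t' x -> t x = t' x.
    move=> ft ft' k m'; rewrite le_eqVlt => /predU1P[//|lt].
    have [h th nth] := sep_witness lt; have [j Ph] := P_cover h.
    have /(acts_sided ft) /sided_rest [] // := key_sided lt k m' th nth Ph.
  have [le|le] := key_comparable m1 k12; first exact: half ft1 ft2 k12 m2 le.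
  by apply/esym; apply: half ft2 ft1 (esym k12) m1 le.
have [j sx] := rest_sided rx; have [y [my xy _]] := sx.
have nbg : ~ bc x y g.
  move=> [z [xz zy zg]]; have := xP z (multicolored_down zy my) zg.
  by rewrite (lt_geF xz).
have [Pjg _] := sided_top sx my xy xg nbg.
have ji := P_disj Pjg Pg; rewrite ji {j ji Pjg} in sx.
(* [g] is in the side of [x], whereas the side of -oo is empty. *)
have px : proper x.
  by have [//|[xp _]] := star_node Tgood lf_leaves x; case: nbg; exact: (xp y xy).2.
have [alone|] := pselect (exists2 y, convex i x y & y <> x).
  exact: pruned_case oP sx px alone.
move=> alone; have {}alone z : convex i x z -> z = x.
  by move=> xz; apply: contrapT => nz; apply: alone; exists z.
have Tx : Theta lf P e x.
  apply: Theta_inf (sx) _; split=> [z /alone ->//|w]; apply; exact: convex_refl.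
apply: (cone_case gx Pg Tx) => f1 t1 f2 t2 ft1 ft2 k12.
have alone_t f t z : acts f t -> convex i (t x) z -> z = t x.
  move=> ft; have [_ [t' _ tK] _] := ft; rewrite -(tK z) => /(acts_convex ft) /alone ->.
  by [].
have s1 : sided i (t1 x) by apply/(acts_sided ft1).
have s2 : sided i (t2 x) by apply/(acts_sided ft2).
have p1 f t : acts f t -> proper (t x).
  move=> ft z; have [_ [t' _ tK] tf] := ft; rewrite -(tK z) (acts_lt ft) => /px [h xh nbh].
  by exists (f h); [rewrite tf|move/(acts_branch_cone ft)].
have [le|le] := key_comparable (sided_multicolored s1) k12.
  by apply/esym; apply: alone_t (ft1) _; apply: key_convex => //; exact: p1 ft1.
by apply: alone_t (ft2) _; apply: key_convex => //; exact: p1 ft2.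
Qed.

End ColoredTree.

(** * Definable sets with parameters *)

Definition fdefinable (L : language) (M : structure L) (X : set M) : Prop :=
  exists2 R : (nat -> M) -> Prop, fdef R & exists s, X = [set x | R (push x s)].

Lemma fdefinable_definable (L : language) (M : structure L) (X : set M) :
  fdefinable X -> definable X.
Proof. by move=> [R dR [s ->]]; exact: fdef_definable. Qed.

Lemma fdefinable_setD (L : language) (M : structure L) (X Y : set M) :
  fdefinable X -> fdefinable Y -> fdefinable (X `\` Y).
Proof.
move=> [R dR [s ->]] [R' dR' [s' ->]].
(* The two parameter assignments are interleaved. *)
pose u n := if odd n then s' n./2 else s n./2.
pose f n := if n is k.+1 then k.*2.+1 else 0%N.
pose f' n := if n is k.+1 then k.*2.+2 else 0%N.
have E x : push x u \o f = push x s.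
  by apply/funext => -[|n] //=; rewrite /u odd_double doubleK.
have E' x : push x u \o f' = push x s'.
  by apply/funext => -[|n] //=; rewrite /u /= odd_double /= uphalf_double.
exists (fun v => R (v \o f) /\ ~ R' (v \o f')).
  by apply: fdef_and; [|apply: fdef_not]; exact: fdef_ren.
by exists u; apply/seteqP; split=> x; rewrite /= E E'.
Qed.

Lemma fdef_Cint (L : language) (C : rsym L 3) (M : structure L) i j k :
  fdef (fun s : nat -> M => Cint C M (s i) (s j) (s k)).
Proof.
apply: fdef_ext (fdef_sat M (FRel C (fun m => Var L m)) (tnth [tuple i; j; k])) => s.
rewrite /Cint /=; suff -> : (fun m => s (tnth [tuple i; j; k] m)) =
  tnth [tuple s i; s j; s k] by [].
by apply/funext => -[[|[|[|//]]] ?].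
Qed.

(** * Interpretation of the canonical tree in the C-structure *)

Section CanonicalTree.
Variables (L : language) (C : rsym L 3) (M : structure L).
Context {d : Order.disp_t} {T : meetSemilatticeType d}.
Variables (lf : M -> T) (g0 : M).
Hypothesis T_canonical : canonical_tree (Cint C M) lf.

Local Notation S := (star T).
Local Notation l g := (of_tree (lf g) : S).

Let Tgood : good_tree T. Proof. by case: T_canonical. Qed.
Let lf_leaves : range lf = @is_leaf d T. Proof. by case: T_canonical. Qed.

(** Meets of [a] with [b] and [c] are comparable with the meet of [b] and [c]; if the latter is not
    below [a], both are below it, hence equal. *)
Lemma Cint_meet a b c : Cint C M a b c <-> ~ (lf b `&` lf c <= lf a)%O.
Proof.
have [_ _ _ CE] := T_canonical; have [chainT _ _] := Tgood; rewrite CE.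
split=> [[_ [_ nsub]] bca|nbca].
  apply: nsub => y [yb yc]; split=> //; apply: le_trans bca.
  by rewrite lexI; apply/andP.
have half b' c' : ~ (lf b' `&` lf c' <= lf a)%O -> (lf a `&` lf b' <= lf c')%O.
  move=> nbc; have [abbc|bcab] := chainT _ _ _ (leIr (lf b') (lf a)) (leIl (lf b') (lf c')).
    by apply: le_trans abbc _; rewrite leIr.
  by case: nbc; apply: le_trans bcab _; rewrite leIl.
have abc := half b c nbca.
have acb : (lf a `&` lf c <= lf b)%O by apply: half; rewrite [X in ~ (X <= _)]meetC.
split; first by apply/seteqP; split=> y [ya yb]; split=> //;
  [apply: le_trans abc|apply: le_trans acb]; rewrite lexI; apply/andP.
split=> [y [ya yb]|H].
  by split=> //; apply: le_trans abc; rewrite lexI; apply/andP.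
have [] : (br (lf a) `&` br (lf b))%classic (lf b `&` lf c)%O.
  by apply: H; split; [exact: leIl|exact: leIr].
by [].
Qed.

Lemma node_or_bottom (x : S) :
  (exists p q, x = of_tree (lf p `&` lf q)%O) \/ star_val x = None.
Proof.
have [[t ->]|[xN _]] := starP x; [left|by right].
have [_ _ /(_ t) [/(leaf_lf lf_leaves) [p ->]|]] := Tgood.
  by exists p, p; rewrite meetxx.
move=> [a [b [/(leaf_lf lf_leaves) [p ->] /(leaf_lf lf_leaves) [q ->] _ ->]]].
by exists p, q.
Qed.

Lemma Cint_iso f a b c : @isomorphism L M M f ->
  Cint C M (f a) (f b) (f c) <-> Cint C M a b c.
Proof.
move=> [_ _ /(_ 3 C (tnth [tuple a; b; c])) fC]; rewrite /Cint fC.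
suff -> : tnth [tuple f a; f b; f c] = f \o tnth [tuple a; b; c] by [].
by apply/funext => -[[|[|[|//]]] ?].
Qed.

Lemma iso_tree f : @isomorphism L M M f -> exists t : S -> S,
  bijective t /\ forall x g, (t x <= l (f g)) = (x <= l g).
Proof.
have ex h : @isomorphism L M M h -> exists t : S -> S,
    forall x g, (t x <= l (h g)) = (x <= l g).
  move=> hi; suff /choice [t tP] : forall x, exists y : S, forall g,
    (y <= l (h g)) = (x <= l g) by exists t.
  move=> x; have [[p [q ->]]|xN] := node_or_bottom x; last first.
    by exists x => g; rewrite !None_le.
  (* By [Cint_meet], the relation C decides which leaves are above the meet of two leaves, and
     automorphisms preserve C. *)
  exists (of_tree (lf (h p) `&` lf (h q))%O) => g; rewrite !of_tree_le.
  apply/idP/idP => pq; apply: contrapT => /Cint_meet; [|move/(Cint_iso _ _ _ hi)].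
    by move/(Cint_iso _ _ _ hi)/Cint_meet.
  by move/Cint_meet.
move=> fi; have [[f' fK f'K] _ _] := fi; have f'i := iso_inv fi fK f'K.
have [t tf] := ex f fi; have [t' t'f] := ex f' f'i.
have tK x g : (t' (t x) <= l g) = (x <= l g) by rewrite -{1}(fK g) t'f tf.
have t'K x g : (t (t' x) <= l g) = (x <= l g) by rewrite -{1}(f'K g) tf t'f.
exists t; split=> //; exists t' => x; apply/le_anti/andP;
  by split; apply: (star_sep g0 Tgood lf_leaves) => g; rewrite ?tK ?t'K.
Qed.

Lemma branch_cone_fdef (x : S) : exists2 B : (nat -> M) -> Prop, fdef B &
  exists s, forall h k, B (push k (push h s)) <-> branch_cone lf x (l h) k.
Proof.
have [[p [q xE]]|xN] := node_or_bottom x; last first.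
  exists (fun=> ~ False); first exact: fdef_not (fdef_false M).
  exists (fun=> g0) => h k; split=> [_|_ []//]; exists (of_tree (lf h `&` lf k)%O).
  rewrite !of_tree_le leIl leIr lt_leAnge None_le //=; split=> //.
  by rewrite /Order.le /= /star_le xN.
pose Cn i j k (s : nat -> M) := Cint C M (s i) (s j) (s k).
exists (fun s => (~ Cn 0%N 2%N 3%N s /\ ~ Cn 1%N 2%N 3%N s) /\
    (Cn 2%N 1%N 0%N s \/ Cn 3%N 1%N 0%N s)).
  apply: fdef_and; [apply: fdef_and; apply: fdef_not|apply: fdef_or];
  exact: fdef_Cint.
(* [h] and [k] share a cone at [x] when both are above [x] and their meet is not [x], that is, not
   below both [p] and [q]. *)
exists (push p (fun=> q)) => h k; rewrite -cone_ofE /Cn /push /= !Cint_meet.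
rewrite /cone_of /= xE of_tree_lt lt_neqAle; split.
  move=> [[/contrapT pqk /contrapT pqh] nhk]; rewrite lexI pqk pqh !andbT.
  apply/eqP => E; case: nhk; apply; rewrite -E; [exact: leIl|exact: leIr].
move=> /andP[/eqP ne]; rewrite lexI => /andP[pqh pqk]; split; first by split; apply.
apply: contrapT => /not_orP [/contrapT hkp /contrapT hkq]; apply: ne.
by apply/le_anti; rewrite !lexI pqh pqk hkp hkq.
Qed.

Lemma fdefinable_thick (x : S) : fdefinable (thick_cone lf x).
Proof.
have [[p [q ->]]|xN] := node_or_bottom x.
  exists (fun s => ~ Cint C M (s 0%N) (s 1%N) (s 2%N)).
    by apply: fdef_not; exact: fdef_Cint.
  exists (push p (fun=> q)); apply/seteqP; split=> g; rewrite /thick_cone /= Cint_meet.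
    by rewrite of_tree_le => pq; apply.
  by move=> /contrapT.
exists (fun=> ~ False); first exact: fdef_not (fdef_false M).
by exists (fun=> g0); apply/seteqP; split=> [g _ []//|g _]; exact: None_le.
Qed.

Lemma fdefinable_branch_cone (x : S) a : fdefinable (branch_cone lf x (l a)).
Proof.
have [B dB [s sP]] := branch_cone_fdef x; exists B => //; exists (push a s).
by apply/seteqP; split=> g /sP.
Qed.

Lemma fdefinable_cones_in (x : S) (Q : set M) : definable0 Q ->
  fdefinable [set h | x < l h /\ branch_cone lf x (l h) `<=` Q].
Proof.
move=> [phi QE]; have [B dB [s sP]] := branch_cone_fdef x.
have dQ : fdef (fun u : nat -> M => Q (u 0%N)).
  apply: fdef_ext (fdef_sat M phi (fun=> 0%N)) => u; rewrite QE /defset /=.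
  suff -> : scons (u 0%N) (noparam M) = u \o (fun=> 0%N) by [].
  by apply/funext => i; rewrite /scons /=; case: unliftP => // -[].
exists (fun u => B (u \o predn) /\ forall k, B (push k u) -> Q (push k u 0%N)).
  apply: fdef_and; first exact: fdef_ren.
  by apply: (fdef_all (R := fun u => B u -> Q (u 0%N))); exact: fdef_imp.
exists s; apply/seteqP; split=> h /=.
  have -> : push h s \o predn = push h (push h s) by apply/funext => -[|[|n]].
  move=> [xh hQ]; split=> [|k /sP /hQ //]; apply/sP; by exists (l h).
have -> : push h s \o predn = push h (push h s) by apply/funext => -[|[|n]].
move=> [/sP [z [xz zh _]] hQ]; split; first exact: lt_le_trans zh.
by move=> k /sP /hQ.
Qed.
End CanonicalTree.

Theorem proposition8p5
  (L : language) (C : rsym L 3) (M : structure L)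
  (L_countable : countable_language L)
  (M_C : Cstructure C M)
  (M_Cminimal : Cminimal C M)
  (M_categorical : aleph0_categorical M)
  (d : Order.disp_t) (T : meetSemilatticeType d) (lf : M -> T)
  (T_canonical : canonical_tree (Cint C M) lf)
  (r : nat) (P : 'I_r -> set M)
  (P_canonical : canonical_partition P)
  (e : 'I_r -> @comb M d T)
  (P_comb : forall i, comb_wf lf (e i) /\ comb_set lf (e i) = P i) :
  let Theta := Theta lf P e in
  forall i : 'I_r, exists X : set M,
    [/\ acl0_definable X, P i = orbit0 X &
        [\/ exists2 x, Theta x & cones lf x X,
            exists2 x, Theta x & almost_thick_cone lf x X
          | exists b a,
              [/\ Theta b, Theta (of_tree a), (b < of_tree a)%O,
                  dense_without_extremities (open_itv b (of_tree a))
                & X = pruned_cone lf b a]]].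
Proof.
move=> Theta i; have [P_ne P_disj P_cover P_def P_max] := P_canonical.
have [Tgood lf_inj lf_leaves _] := T_canonical.
have [g0 _] := infinite_setN0 (categorical_infinite M_categorical).
pose Aut : set (M -> M) := [set f | isomorphism f].
have Aut_P f j g : Aut f -> P j (f g) <-> P j g.
  have [phi ->] := P_def j => fi; rewrite /defset /= -(iso_sat phi (scons g _) fi).
  suff -> : f \o scons g (noparam M) = scons (f g) (noparam M) by [].
  by apply/funext => k; rewrite /scons /=; case: unliftP => // -[].
have Aut_trans j g h : P j g -> P j h -> exists2 f, Aut f & f g = h.
  move=> Pg Ph; have [f fi fg] := same_type0_conj L_countable M_categorical ((P_max j).1 g h Pg Ph).
  by exists f.
have [|||||||||X [[g Xg] XP dX fX shape]] := @classification M d T lf g0 Tgood lf_leaves r P e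
  _ _ (fun j => (P_comb j).2) Aut (@fdefinable L M) lf_inj
  (@iso_tree L C M d T lf g0 T_canonical) _ Aut_P Aut_trans _ _ _ _ _ i.
- move=> j k g Pj Pk; apply: contrapT => jk.
  by have : (P j `&` P k) g by []; rewrite P_disj.
- by move=> g; have : [set: M] g by []; rewrite -P_cover => -[j _ Pj]; exists j.
- by move=> f [[f' _ fK] _ _] h; exists (f' h).
- exact: pairs_conj.
- by move=> x; exact: (fdefinable_thick g0 T_canonical).
- by move=> x a _; exact: (fdefinable_branch_cone g0 T_canonical).
- by move=> x j; apply: (fdefinable_cones_in g0 T_canonical).
- exact: fdefinable_setD.
- exact: P_ne.
exists X; split=> //.
  exact: finite_conj_acl0 (fdefinable_definable dX) fX.
apply/seteqP; split=> [h Ph|_ [f fi [h /XP Ph <-]]]; last exact/Aut_P.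
by have [f fi <-] := Aut_trans i g h (XP g Xg) Ph; exists f => //; exists g.
Qed.
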